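(* Let $P(u)=\sum_{s\in\mathcal{S}}p_su^s$ be the step polynomial of an aperiodic weighted step set $\mathcal{S}$. Let $X_n$ denote the number of returns to zero of a random walk of length $n$ with steps in $\mathcal{S}$. Let $\delta=P'(1)$ be the drift. Then, for $n\to\infty$: 1. if $\delta\neq 0$, one has convergence in law to a geometric distribution: $$X_n\stackrel{d}{\to}\operatorname{Geom}\left(\frac{1}{B(1/P(1))}\right);$$ 2. if $\delta=0$, one has convergence in law to a half-normal distribution: $$\frac{X_n}{\sqrt n}\stackrel{d}{\to}\mathcal{H}\left(\sqrt{\frac{P(1)}{P''(1)}}\right).$$
   Context: A step set $\mathcal{S}\subset\mathbb{Z}$ is a finite set of integers containing at least one negative and at least one positive number; each step $s\in\mathcal{S}$ has a weight $p_s>0$. A walk (lattice path) of length $n$ is a sequence $(s_1,\dots,s_n)\in\mathcal{S}^n$, identified with its altitudes $(\omega_0,\omega_1,\dots,\omega_n)$, $\omega_0=0$, $\omega_i-\omega_{i-1}=s_i$. Its weight is the product of the weights of its steps. A random walk of length $n$ is chosen among all walks of length $n$ with probability proportional to its weight (total weight $P(1)^n$). The step set is periodic if there are a polynomial $H$ and integers $b\in\mathbb{Z}$, $p>1$ with $P(u)=u^bH(u^p)$; otherwise it is aperiodic. A return to zero is a point of the walk of altitude $0$ different from the starting point, i.e. an index $i\ge1$ with $\omega_i=0$. A bridge is a walk with $\omega_n=0$; $B(z)=\sum_{n\ge0}b_nz^n$, where $b_n$ is the total weight of bridges of length $n$ (including the empty one, $b_0=1$). $\operatorname{Geom}(\lambda)$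 is the distribution on $\{0,1,2,\dots\}$ with $\mathbb{P}(X=k)=\lambda(1-\lambda)^k$. $\mathcal{H}(\sigma)$ is the half-normal distribution with density $\sqrt{\frac{2}{\pi\sigma^2}}\exp\left(-\frac{x^2}{2\sigma^2}\right)$, $x\ge0$. *)

(* Defs.v *)
From HB Require Import structures.
From mathcomp Require Import all_boot all_order all_algebra.
From mathcomp Require Import finmap ring.
From mathcomp Require Import all_classical all_reals all_analysis.
From mathcomp Require Import measurable_realfun.

Set Implicit Arguments.
Unset Strict Implicit.
Unset Printing Implicit Defensive.

Import Order.TTheory GRing.Theory Num.Theory.
Import numFieldNormedType.Exports.

Local Open Scope classical_set_scope.
Local Open Scope ring_scope.

Record step_set (R : realType) := StepSet {
  steps : {fset int};
  step_weight : steps -> R;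
  step_weight_gt0 : forall s : steps, 0 < step_weight s;
  has_neg_step : exists s : steps, val s < 0;
  has_pos_step : exists s : steps, 0 < val s }.

(* The exponents are integers, possibly negative, so the step polynomial is a
   Laurent polynomial; it is represented by the function u |-> P(u). *)
Definition step_poly (R : realType) (S : step_set R) (u : R) : R :=
  \sum_(s : steps S) step_weight s * u ^ val s.

(* P(u) = u^b H(u^q); as R is infinite, equality of Laurent polynomials is
   equality of values at all nonzero points. *)
Definition periodic (R : realType) (S : step_set R) : Prop :=
  exists (H : {poly R}) (b : int) (q : nat), (1 < q)%N /\
    forall u : R, u != 0 -> step_poly S u = u ^ b * H.[u ^+ q].

Definition aperiodic (R : realType) (S : step_set R) : Prop := ~ periodic S.

Definition walk (R : realType) (S : step_set R) (n : nat) : Type :=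
  n.-tuple (steps S).

HB.instance Definition _ R S n := Finite.on (@walk R S n).
HB.instance Definition _ R S n := isPointed.Build (@walk R S n)
  (nseq_tuple n (sval (cid (has_neg_step S)))).
HB.instance Definition _ R S n := @isMeasurable.Build default_measure_display
  (@walk R S n) discrete_measurable discrete_measurable0
  discrete_measurableC discrete_measurableU.

Definition altitude (R : realType) (S : step_set R) (n : nat) (w : walk S n)
  (i : nat) : int := \sum_(s <- take i w) val s.

Definition walk_weight (R : realType) (S : step_set R) (n : nat)
  (w : walk S n) : R := \prod_(i < n) step_weight (tnth w i).

Definition returns_to_zero (R : realType) (S : step_set R) (n : nat)
  (w : walk S n) : nat :=
  count (fun i => altitude w i == 0) (iota 1 n).

Definition bridge_weight (R : realType) (S : step_set R) (n : nat) : R :=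
  \sum_(w : walk S n | altitude w n == 0) walk_weight w.

(* Sum of the series in R; as for any lim, the value is unspecified where the
   series diverges. *)
Definition bridge_gf (R : realType) (S : step_set R) (z : R) : R :=
  limn (pseries (bridge_weight S) z).

Definition walk_prob (R : realType) (S : step_set R) (n : nat)
  (A : set (walk S n)) : \bar R :=
  (\sum_(w : walk S n | w \in A) walk_weight w / step_poly S 1 ^+ n)%:E.

Section walk_prob_is_probability.
Context (R : realType) (S : step_set R) (n : nat).

Let step_poly1_gt0 : 0 < step_poly S 1.
Proof.
have [s _] := has_neg_step S.
rewrite /step_poly (bigD1 s)//= exp1rz mulr1 ltr_pwDl ?step_weight_gt0//.
by apply: sumr_ge0 => t _; rewrite exp1rz mulr1 ltW ?step_weight_gt0.
Qed.

Let pr (w : walk S n) : R := walk_weight w / step_poly S 1 ^+ n.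

Let pr_ge0 w : 0 <= pr w.
Proof.
apply: mulr_ge0; last by rewrite invr_ge0 exprn_ge0// ltW.
by apply: prodr_ge0 => i _; rewrite ltW ?step_weight_gt0.
Qed.

Let walk_prob_esum (A : set (walk S n)) :
  walk_prob A = (\esum_(w in A) (pr w)%:E)%E.
Proof.
have fA : finite_set A by exact: finite_finset.
rewrite esum_fset//.
rewrite (@fsbigE _ _ _ _ _ [seq w <- enum {: walk S n} | w \in A]).
- rewrite /walk_prob -sumEFin big_filter_cond big_enum_cond/=.
  by apply: eq_bigl => w; rewrite andbb.
- by rewrite filter_uniq// enum_uniq.
- by move=> w; rewrite /= mem_filter => /andP[/set_mem].
- by move=> w Aw; rewrite mem_filter mem_enum inE andbT => /negP; rewrite inE.
- by move=> w _; rewrite lee_fin pr_ge0.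
Qed.

Let walk_prob0 : walk_prob (set0 : set (walk S n)) = 0%E.
Proof. by rewrite walk_prob_esum esum_set0. Qed.

Let walk_prob_ge0 (A : set (walk S n)) : (0 <= walk_prob A)%E.
Proof. by rewrite lee_fin; apply: sumr_ge0 => w _; exact: pr_ge0. Qed.

Let walk_prob_sigma_additive : semi_sigma_additive (@walk_prob R S n).
Proof.
move=> F mF tF mUF; rewrite walk_prob_esum nneseries_sum_bigcup//.
under [X in X @ _ --> _]eq_fun do under eq_bigr do rewrite walk_prob_esum.
by apply: is_cvg_nneseries => i _ _; apply: esum_ge0 => w _; rewrite lee_fin.
Qed.

HB.instance Definition _ := isMeasure.Build _ _ _ (@walk_prob R S n)
  walk_prob0 walk_prob_ge0 walk_prob_sigma_additive.

Let walk_probT : walk_prob [set: walk S n] = 1%E.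
Proof.
rewrite /walk_prob; congr EFin; rewrite -mulr_suml.
rewrite (eq_bigl xpredT) => [|w]; last by rewrite in_setT.
suff -> : \sum_(w : walk S n) walk_weight w = step_poly S 1 ^+ n.
  by rewrite divff// expf_neq0// gt_eqF.
under [step_poly S 1]eq_bigr do rewrite exp1rz mulr1.
rewrite -[in RHS](card_ord n) -prodr_const bigA_distr_bigA/=.
rewrite (reindex (fun f : {ffun 'I_n -> steps S} => [tuple f i | i < n])) /=.
  by apply: eq_bigr => f _; apply: eq_bigr => i _; rewrite tnth_mktuple.
exists (fun w => [ffun i => tnth w i]) => [f _|w _].
  by apply/ffunP => i; rewrite ffunE tnth_mktuple.
by apply: eq_from_tnth => i; rewrite tnth_mktuple ffunE.
Qed.

HB.instance Definition _ :=
  @Measure_isProbability.Build _ _ R (@walk_prob R S n) walk_probT.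

End walk_prob_is_probability.

Definition num_returns (R : realType) (S : step_set R) (n : nat)
  (w : walk S n) : R := (returns_to_zero w)%:R.

HB.instance Definition _ R S n :=
  isMeasurableFun.Build _ _ _ _ (@num_returns R S n) (fun _ _ _ => I).

Definition scaled_num_returns (R : realType) (S : step_set R) (n : nat)
  (w : walk S n) : R := num_returns w / Num.sqrt n%:R.

HB.instance Definition _ R S n :=
  isMeasurableFun.Build _ _ _ _ (@scaled_num_returns R S n) (fun _ _ _ => I).

(* Pointwise convergence of the distribution functions at the continuity points
   of the limiting one; each X n may live on its own probability space. *)
Definition cvg_in_law (R : realType) (d : nat -> measure_display)
    (T : forall n, measurableType (d n)) (P : forall n, probability (T n) R)
    (X : forall n, {RV (P n) >-> R})
    (mu : probability (measurableTypeR R) R) : Prop :=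
  let F := (fun x : R => mu `]-oo, x]%classic) in
  forall x : R, {for x, continuous F} -> cdf (X n) x @[n --> \oo] --> F x.

Arguments walk_prob {R} S n.
Arguments num_returns {R} S n.
Arguments scaled_num_returns {R} S n.
Arguments cvg_in_law {R d T} P X mu.

Definition geometric_pmf (R : realType) (lambda : R) (k : nat) : R :=
  lambda * (1 - lambda) ^+ k.

(* Geom(lambda) as a law on the reals, supported on the natural numbers.
   Outside 0 < lambda <= 1 it is given the dummy value \d_0, so that it is
   always a probability. *)
Definition geometric_prob (R : realType) (lambda : R)
    (A : set (measurableTypeR R)) : \bar R :=
  if 0 < lambda <= 1 then
    (\esum_(k in [set k : nat | A k%:R]) (geometric_pmf lambda k)%:E)%E
  else \d_(0 : measurableTypeR R) A.

Section geometric_prob_is_probability.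
Context (R : realType) (lambda : R).
Local Open Scope ereal_scope.

Local Notation geom := (geometric_prob lambda).

Let pmf_ge0 k : (0 < lambda <= 1)%R -> 0 <= (geometric_pmf lambda k)%:E.
Proof.
by move=> /andP[l0 l1]; rewrite lee_fin mulr_ge0 ?exprn_ge0 ?subr_ge0// ltW.
Qed.

Let geom0 : geom set0 = 0.
Proof. by rewrite /geometric_prob measure0; case: ifPn => //; rewrite esum_set0. Qed.

Let geom_ge0 A : 0 <= geom A.
Proof.
rewrite /geometric_prob; case: ifPn => // l01.
by apply: esum_ge0 => k _; exact: pmf_ge0.
Qed.

Let geom_sigma_additive : semi_sigma_additive geom.
Proof.
move=> F mF tF mUF; rewrite /geometric_prob; case: ifPn => l01; last first.
  exact: measure_semi_sigma_additive.
apply: cvg_toP.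
  apply: ereal_nondecreasing_is_cvgn => a b ab.
  by apply: lee_sum_nneg_natr => // n _ _; apply: esum_ge0 => k _; exact: pmf_ge0.
rewrite -[LHS]nneseries_sum_bigcup//; last by move=> k; exact: pmf_ge0.
move=> i j _ _ [k [/= Fik Fjk]].
by apply: (tF i j) => //; exists k%:R.
Qed.

HB.instance Definition _ := isMeasure.Build _ _ _ geom
  geom0 geom_ge0 geom_sigma_additive.

Let geom_setT : geom [set: _] = 1.
Proof.
rewrite /geometric_prob; case: ifPn => [l01|_]; last by rewrite probability_setT.
rewrite (_ : [set k | _] = [set: nat]); last by apply/seteqP; split.
rewrite -nneseries_esumT; last by move=> k; exact: pmf_ge0.
have /andP[l0 l1] := l01.
have q1 : (`|1 - lambda| < 1)%R by rewrite ger0_norm ?subr_ge0// gtrBl.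
rewrite (_ : 1 = (lambda * (1 - (1 - lambda))^-1)%R%:E); last first.
  by rewrite subKr divff// gt_eqF.
apply/cvg_lim => //.
rewrite (_ : (fun n => _) = EFin \o series (geometric lambda (1 - lambda)%R)).
  by apply: cvg_EFin; [exact: nearW|exact: cvg_geometric_series].
by apply/funext => n; rewrite /= /series/= -sumEFin.
Qed.

HB.instance Definition _ :=
  @Measure_isProbability.Build _ _ R geom geom_setT.

End geometric_prob_is_probability.

(* For sigma = 0 the formula is not a density; as in normal_pdf, the dummy
   value is the uniform density on [0, 1]. *)
Definition halfnormal_pdf (R : realType) (sigma x : R) : R :=
  if sigma == 0 then \1_`[0, 1] x
  else if 0 <= x then
    Num.sqrt (2 / (pi * sigma ^+ 2)) * expR (- (x ^+ 2 / (2 * sigma ^+ 2)))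
  else 0.

Definition halfnormal_prob (R : realType) (sigma : R)
    (A : set (measurableTypeR R)) : \bar R :=
  (\int[lebesgue_measure]_(x in A) (halfnormal_pdf sigma x)%:E)%E.

Section halfnormal_prob_is_probability.
Context (R : realType) (sigma : R).
Local Notation mu := (@lebesgue_measure R).
Local Notation hn := (halfnormal_prob sigma).

Let Nset : set R := [set x | 0 <= x].

Let mNset : measurable Nset.
Proof. by rewrite /Nset -set_itvcy. Qed.

Let pdfE : sigma != 0 ->
  halfnormal_pdf sigma = (fun x => 2 * normal_pdf 0 sigma x) \_ Nset.
Proof.
move=> s0; apply/funext => x; rewrite /halfnormal_pdf (negbTE s0) patchE.
case: (boolP (0 <= x)) => x0; last by rewrite memNset//; exact/negP.
rewrite mem_set// normal_pdfE// /normal_peak /normal_fun subr0 [RHS]mulrA mulNr.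
congr (_ * expR (- (_ / _))); last by rewrite mulr_natl.
apply/eqP; rewrite -(@eqrXn2 _ 2)// ?sqrtr_ge0 ?mulr_ge0 ?invr_ge0 ?sqrtr_ge0//.
rewrite exprMn exprVn !sqr_sqrtr.
- rewrite -mulr_natr; apply/eqP.
  have p0 : (pi : R) != 0 by rewrite gt_eqF ?pi_gt0.
  by move: (@pi R) p0 => q q0; field; rewrite s0 q0.
- by rewrite mulrn_wge0// mulr_ge0 ?sqr_ge0 ?pi_ge0.
- by rewrite divr_ge0// mulr_ge0 ?sqr_ge0 ?pi_ge0.
Qed.

Let pdf_ge0 x : 0 <= halfnormal_pdf sigma x.
Proof.
by rewrite /halfnormal_pdf; case: ifPn => // _; case: ifPn.
Qed.

Let measurable_pdf : measurable_fun setT (halfnormal_pdf sigma).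
Proof.
have [s0|s0] := eqVneq sigma 0.
  by rewrite /halfnormal_pdf s0 eqxx; exact: measurable_indic.
rewrite pdfE//; apply/(measurable_restrictT _ _).1 => //.
by apply: measurable_funTS; apply: measurable_funM => //; exact: measurable_normal_pdf.
Qed.

Let measurable_pdfE D : measurable_fun D (EFin \o halfnormal_pdf sigma).
Proof. by apply: measurable_funTS; exact/measurable_EFinP. Qed.

Let hn0 : hn set0 = 0%E.
Proof. by rewrite /halfnormal_prob integral_set0. Qed.

Let hn_ge0 A : (0 <= hn A)%E.
Proof. by apply: integral_ge0 => x _; rewrite lee_fin. Qed.

Let hn_sigma_additive : semi_sigma_additive hn.
Proof.
move=> A mA tA mUA; rewrite /halfnormal_prob.
have f0 x : (\bigcup_k A k) x -> (0 <= (halfnormal_pdf sigma x)%:E)%E.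
  by rewrite lee_fin.
have mf := @measurable_pdfE (\bigcup_k A k).
rewrite (ge0_integral_bigcup mu mA mf f0 tA).
by apply: is_cvg_nneseries => n _ _; apply: integral_ge0 => x _; rewrite lee_fin.
Qed.

HB.instance Definition _ := isMeasure.Build _ _ _ hn
  hn0 hn_ge0 hn_sigma_additive.

Let hn_setT : hn [set: _] = 1%E.
Proof.
rewrite /halfnormal_prob; have [s0|s0] := eqVneq sigma 0.
  rewrite /halfnormal_pdf s0 eqxx integral_indic//= setIT.
  by rewrite lebesgue_measure_itv/= lte01 oppr0 adde0.
rewrite pdfE// -[RHS](integral_normal_pdf 0 sigma) [RHS]ge0_symfun_integralT.
- rewrite -ge0_integralZl//=.
  + rewrite [RHS]integral_mkcond/=; apply: eq_integral => x _.
    by rewrite !patchE; case: ifPn.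
  + apply: measurable_funTS; apply/measurable_EFinP.
    exact: measurable_normal_pdf.
  + by move=> x _; rewrite lee_fin normal_pdf_ge0.
- by move=> x; exact: normal_pdf_ge0.
- exact: continuous_normal_pdf.
- by move=> x/=; rewrite !normal_pdfE// /normal_fun !subr0 sqrrN.
Qed.

HB.instance Definition _ :=
  @Measure_isProbability.Build _ _ R hn hn_setT.

End halfnormal_prob_is_probability.

(* Main.v *)
Require Import Defs.
From HB Require Import structures.
From mathcomp Require Import all_boot all_order all_algebra.
From mathcomp Require Import finmap ring lra zify.
From mathcomp Require Import all_classical all_reals all_analysis.
From mathcomp Require Import measurable_realfun.

(** Let [avg] average a function over one step of the walk, and let [green z x]
be the expected number of visits to 0 of the walk started at x, where the visit
at time n has weight z ^ n; at x = 0 this is B(z / P(1)).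

The link between returns and visits is that the number of returns is a
geometric variable with ratio 1 - 1 / green, in two ways. For the infinite
transient walk, splitting at the return that is followed by exactly k others
([tail_renewal]) gives v_(k+1) = (B - 1) (v_k - v_(k+1)) for the limiting tails
v_k. For any step set, the number of returns before an independent geometric
time of parameter 1 - z is exactly geometric ([discounted_tail]).

If the drift is not zero, P(u) < P(1) for some u > 0, so that the probability of
being at 0 at time n decays exponentially. Then B converges at 1 / P(1) and the
first identity gives the geometric law with parameter 1 / B(1 / P(1)).

If the drift is zero, let v be the step variance. The second identity is turned
into a limit law in three steps.

(1) 1 / green z 0 is equivalent to the square root of 2 v (1 - z) when z tends to
1 ([cvg_inv_green]). This is proved by real-variable potential theory. The
function h(x) = exp(- a |x|) with a ^ 2 = 2 (1 - z) / v almost solves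
h = z avg h away from a bounded window around 0, hence h is almost a combination
of translates of the Green function with poles in the window
([discounted_bound]); these translates are all equivalent to green z 0 by
irreducibility ([aperiodic_reachable], [cvg_green_ratio]), and their coefficients
sum up to a v at first order.

(2) Let T_k be the time of the k-th return. By (1) and the second identity, if
k / sqrt n tends to x then E(exp (- j T_k / n)) tends to
exp(- sqrt (2 j) x sqrt v) for all integers j > 0. This is the expectation of
Y ^ j, where Y = exp(- (x / U) ^ 2) and U is half-normal of parameter
1 / sqrt v: the half-normal density times exp(- b ^ 2 / (2 sg ^ 2 u ^ 2)) has an
explicit antiderivative in terms of the normal distribution function
([is_derive_passage]).

(3) The event X_n >= k is T_k <= n, that is exp(- T_k / n) >= exp(- 1), and the
polynomials 1 - (1 - y ^ a) ^ b approximate the indicator of such an event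
([exists_step_polynomial]). Hence its probability tends to that of
Y >= exp(- 1), which is U >= x. *)

Set Implicit Arguments.
Unset Strict Implicit.
Unset Printing Implicit Defensive.

Import Order.TTheory GRing.Theory Num.Theory.
Import numFieldNormedType.Exports.

Local Open Scope classical_set_scope.
Local Open Scope ring_scope.

(** * Discounted sums and averages over one step *)

Section discounted_sums.
Context (R : realType).
Implicit Types (z : R) (a : nat -> R).

Lemma is_cvg_discounted (a : nat -> R) z : 0 <= z < 1 -> (forall n, 0 <= a n <= 1) ->
  cvgn (series (fun n => z ^+ n * a n)).
Proof.
move=> /andP[z0 z1] a01; apply: (@series_le_cvg _ _ (geometric 1 z)).
- by move=> n; have /andP[a0 _] := a01 n; rewrite mulr_ge0 ?exprn_ge0.
- by move=> n; rewrite /= mul1r exprn_ge0.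
- move=> n; have /andP[a0 a1] := a01 n.
  by rewrite /= mul1r ler_piMr ?exprn_ge0.
- by apply: is_cvg_geometric_series; rewrite ger0_norm.
Qed.

Definition discounted z (a : nat -> R) : R := limn (series (fun n => z ^+ n * a n)).

Lemma discounted_ge0 z a : 0 <= z < 1 -> (forall n, 0 <= a n <= 1) -> 0 <= discounted z a.
Proof.
move=> z01 a01; apply: limr_ge; first exact: is_cvg_discounted.
have /andP[z0 _] := z01.
apply: nearW => n; apply: sumr_ge0 => i _; have /andP[a0 _] := a01 i.
by rewrite mulr_ge0 ?exprn_ge0.
Qed.

Lemma discounted_le z a : 0 <= z < 1 -> (forall n, 0 <= a n <= 1) ->
  discounted z a <= (1 - z)^-1.
Proof.
move=> z01 a01; have /andP[z0 z1] := z01.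
apply: limr_le; first exact: is_cvg_discounted.
apply: nearW => n; apply: (@le_trans _ _ (series (geometric 1 z) n)).
  apply: ler_sum => i _; have /andP[_ a1] := a01 i.
  by rewrite /= mul1r ler_piMr ?exprn_ge0.
rewrite geometric_seriesE ?lt_eqF//= mul1r ler_piMl//.
  by rewrite invr_ge0 subr_ge0 ltW.
by rewrite lerBlDr lerDl exprn_ge0.
Qed.

Lemma discounted_rec z a : 0 <= z < 1 -> (forall n, 0 <= a n <= 1) ->
  discounted z a = a 0%N + z * discounted z (fun n => a n.+1).
Proof.
move=> z01 a01.
have cS : series (fun n => z ^+ n * a n.+1) @ \oo --> discounted z (fun n => a n.+1).
  by apply: is_cvg_discounted.
apply/cvg_lim => //; rewrite -cvg_shiftS.
rewrite (_ : (fun n => _) = (fun n => a 0%N + z * series (fun n => z ^+ n * a n.+1) n)).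
  by apply: cvgD; [exact: cvg_cst|apply: cvgM cS; exact: cvg_cst].
apply/funext => n; rewrite /series/= big_nat_recl// expr0 mul1r; congr (_ + _).
by rewrite mulr_sumr; apply: eq_bigr => i _; rewrite mulrA exprS.
Qed.

Lemma cvg_lincomb (I : Type) (r : seq I) (c : I -> R) (u : I -> nat -> R)
  (l : I -> R) : (forall i, u i @ \oo --> l i) ->
  (fun n => \sum_(i <- r) c i * u i n) @ \oo --> \sum_(i <- r) c i * l i.
Proof.
move=> ul; elim: r => [|i r IH].
  rewrite big_nil (_ : (fun _ => _) = cst 0); first exact: cvg_cst.
  by apply/funext => n; rewrite big_nil.
rewrite big_cons (_ : (fun _ => _) =
  (fun n => c i * u i n + \sum_(j <- r) c j * u j n)).
  by apply: cvgD IH; apply: cvgM (ul i); exact: cvg_cst.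
by apply/funext => n; rewrite big_cons.
Qed.

Lemma discounted_lincomb z (I : Type) (r : seq I) (c : I -> R) (a : I -> nat -> R) :
  0 <= z < 1 -> (forall i n, 0 <= a i n <= 1) ->
  discounted z (fun n => \sum_(i <- r) c i * a i n) = \sum_(i <- r) c i * discounted z (a i).
Proof.
move=> z01 a01; apply/cvg_lim => //.
rewrite (_ : series _ = (fun n => \sum_(i <- r) c i * series (fun n => z ^+ n * a i n) n)).
  by apply: cvg_lincomb => i; exact: is_cvg_discounted.
apply/funext => n; rewrite /series/=.
under [RHS]eq_bigr do rewrite mulr_sumr.
rewrite [RHS]exchange_big/=; apply: eq_bigr => k _.
by rewrite mulr_sumr; apply: eq_bigr => i _; rewrite mulrCA.
Qed.

End discounted_sums.

Section averaging.
Context (R : realType) (S : step_set R).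
Implicit Types (h d : int -> R) (x y : int) (s : steps S) (n k : nat) (z e M : R).

Lemma step_poly1E : step_poly S 1 = \sum_(s : steps S) step_weight s.
Proof. by apply: eq_bigr => s _; rewrite exp1rz mulr1. Qed.

Lemma step_poly1_gt0 : 0 < step_poly S 1.
Proof.
have [s _] := has_neg_step S.
rewrite step_poly1E (bigD1 s)//= ltr_pwDl ?step_weight_gt0//.
by apply: sumr_ge0 => t _; rewrite ltW ?step_weight_gt0.
Qed.

Definition step_prob s : R := step_weight s / step_poly S 1.

Lemma step_prob_gt0 s : 0 < step_prob s.
Proof. by rewrite divr_gt0 ?step_weight_gt0 ?step_poly1_gt0. Qed.

Lemma step_prob_ge0 s : 0 <= step_prob s. Proof. exact/ltW/step_prob_gt0. Qed.

Lemma sum_step_prob : \sum_s step_prob s = 1.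
Proof. by rewrite -mulr_suml -step_poly1E divff// gt_eqF ?step_poly1_gt0. Qed.

Definition avg h x : R := \sum_s step_prob s * h (x + val s).

Lemma avgD h d x : avg (fun y => h y + d y) x = avg h x + avg d x.
Proof. by rewrite -big_split; apply: eq_bigr => s _; rewrite mulrDr. Qed.

Lemma avgZ c h x : avg (fun y => c * h y) x = c * avg h x.
Proof. by rewrite mulr_sumr; apply: eq_bigr => s _; rewrite mulrCA. Qed.

Lemma avgB h d x : avg (fun y => h y - d y) x = avg h x - avg d x.
Proof.
rewrite -mulN1r -avgZ -avgD; apply: eq_bigr => s _.
by rewrite mulN1r.
Qed.

Lemma avg_cst c x : avg (fun=> c) x = c.
Proof. by rewrite /avg -mulr_suml sum_step_prob mul1r. Qed.

Lemma avg_le h d x : (forall y, h y <= d y) -> avg h x <= avg d x.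
Proof. by move=> hd; apply: ler_sum => s _; rewrite ler_wpM2l ?step_prob_ge0. Qed.

Lemma ler_norm_avg h x : `|avg h x| <= avg (fun y => `|h y|) x.
Proof.
rewrite (le_trans (ler_norm_sum _ _ _))//; apply: ler_sum => s _.
by rewrite normrM (ger0_norm (step_prob_ge0 s)).
Qed.

Lemma avg_shift h y x : avg (fun t => h (t + y)) x = avg h (x + y).
Proof. by apply: eq_bigr => s _; rewrite addrAC. Qed.

Lemma avg_sum (I : Type) (r : seq I) (c : I -> R) (g : I -> int -> R) x :
  avg (fun y => \sum_(i <- r) c i * g i y) x = \sum_(i <- r) c i * avg (g i) x.
Proof.
elim: r => [|i r IH].
  by rewrite big_nil -[RHS](avg_cst 0 x); apply: eq_bigr => s _; rewrite big_nil.
rewrite big_cons -IH -avgZ -avgD; apply: eq_bigr => s _.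
by rewrite big_cons.
Qed.

(** The averaging operator is a contraction for the supremum norm: the supremum m
of |d| satisfies m <= e + z m. For e = 0 this is uniqueness of bounded solutions
of d = z avg d + source; for e > 0 it measures how far an approximate solution is
from the exact one. *)
Lemma discounted_bound z d e M : 0 <= z < 1 -> (forall x, `|d x| <= M) ->
  (forall x, `|d x - z * avg d x| <= e) -> forall x, `|d x| <= e / (1 - z).
Proof.
move=> /andP[z0 z1] dM de.
have supA : has_sup [set `|d x| | x in [set: int]].
  by split; [exists `|d 0|; exists 0 | exists M => _ [x _ <-]].
set m := sup [set `|d x| | x in [set: int]].
have dm x : `|d x| <= m by apply: (ub_le_sup supA.2); exists x.
have step x : `|d x| <= e + z * m.
  rewrite -[d x](subrK (z * avg d x)) (le_trans (ler_normD _ _))// lerD//.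
  rewrite normrM (ger0_norm z0) ler_wpM2l//.
  rewrite (le_trans (ler_norm_avg _ _))// -[leRHS](avg_cst m x).
  by apply: avg_le.
have me : m <= e + z * m by apply: ge_sup; [exact: supA.1|move=> _ [x _ <-]].
by move=> x; rewrite (le_trans (dm x))// ler_pdivlMr ?subr_gt0//; lra.
Qed.

Definition at0 x : R := (x == 0)%:R.

(** The probability that the walk started at x is at 0 at time n. *)
Definition visits n : int -> R := iter n avg at0.

Lemma visitsS n x : visits n.+1 x = avg (visits n) x. Proof. by []. Qed.

Lemma visits_ge0 n x : 0 <= visits n x.
Proof.
elim: n x => [|n IH] x; first exact: ler0n.
by rewrite visitsS -(avg_cst 0 x) avg_le.
Qed.

Lemma visits_le1 n x : visits n x <= 1.
Proof.
elim: n x => [|n IH] x; first by rewrite /= /at0; case: eqP => _; rewrite ?lexx ?ler01.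
by rewrite visitsS -(avg_cst 1 x) avg_le.
Qed.

End averaging.

(** * The Green function and the number of returns *)

Section green_function.
Context (R : realType) (S : step_set R).
Implicit Types (x y : int) (n k : nat) (z : R).

Local Notation avg := (avg S).
Local Notation visits := (visits S).

Lemma visits01 x n : 0 <= visits n x <= 1.
Proof. by rewrite visits_ge0 visits_le1. Qed.

Definition green z x : R := discounted z (visits ^~ x).

Lemma green_ge0 z x : 0 <= z < 1 -> 0 <= green z x.
Proof. by move=> z01; apply: discounted_ge0 => // n; exact: visits01. Qed.

Lemma green_le z x : 0 <= z < 1 -> green z x <= (1 - z)^-1.
Proof. by move=> z01; apply: discounted_le => // n; exact: visits01. Qed.

Lemma greenE z x : 0 <= z < 1 -> green z x = at0 R x + z * avg (green z) x.
Proof.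
move=> z01; rewrite /green discounted_rec//; last by move=> n; exact: visits01.
congr (_ + _ * _); rewrite /= /avg -discounted_lincomb//.
by move=> s n; exact: visits01.
Qed.

Lemma green0_ge1 z : 0 <= z < 1 -> 1 <= green z 0.
Proof.
move=> z01; rewrite greenE// /at0 eqxx lerDl mulr_ge0//.
  by case/andP: z01.
rewrite -(avg_cst S 0 0); apply: avg_le => y; exact: green_ge0.
Qed.

(** Away from 0 the Green function is z times an average of its own values, so
that it stays below z times its supremum there; the supremum is reached at 0. *)
Lemma green_max z x : 0 <= z < 1 -> green z x <= green z 0.
Proof.
move=> z01; have /andP[z0 z1] := z01.
have supA : has_sup [set green z x | x in [set: int]].
  split; first by exists (green z 0); exists 0.
  by exists (1 - z)^-1 => _ [y _ <-]; exact: green_le.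
set m := sup [set green z x | x in [set: int]].
have gm y : green z y <= m by apply: (ub_le_sup supA.2); exists y.
have m0 : 0 < m by apply: lt_le_trans (gm 0); apply: lt_le_trans (green0_ge1 z01).
have [g0m|mg0] := leP m (green z 0); first exact: le_trans (gm x) g0m.
have : m <= Num.max (green z 0) (z * m).
  apply: ge_sup; [exact: supA.1|move=> _ [y _ <-]].
  rewrite le_max; have [->|y0] := eqVneq y 0; first by rewrite lexx.
  rewrite greenE// /at0 (negbTE y0) add0r ler_wpM2l ?orbT//.
  by rewrite -[leRHS](avg_cst S m y); exact: avg_le.
rewrite le_max leNgt mg0/= leNgt => /negP[].
by rewrite gtr_pMl.
Qed.

(** The probability of at least k returns to 0 in n steps from x, defined by
conditioning on the first step. *)
Fixpoint tail k n x : R :=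
  match n, k with
  | _, 0%N => 1
  | 0%N, _.+1 => 0
  | n'.+1, k'.+1 =>
    avg (fun y => if y == 0 then tail k' n' y else tail k n' y) x
  end.

Lemma tail0 n x : tail 0 n x = 1. Proof. by case: n. Qed.

Lemma tailS0 k x : tail k.+1 0 x = 0. Proof. by []. Qed.

Lemma tailSS k n x : tail k.+1 n.+1 x =
  avg (fun y => if y == 0 then tail k n 0 else tail k.+1 n y) x.
Proof. by rewrite /=; apply: eq_bigr => s _; case: eqP => // ->. Qed.

Lemma tail01 k n x : 0 <= tail k n x <= 1.
Proof.
elim: n k x => [|n IH] [|k] x; rewrite ?tail0 ?tailS0 ?lexx ?ler01// tailSS.
rewrite -[X in X <= _](avg_cst S 0 x) -[X in _ <= _ <= X](avg_cst S 1 x).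
have H y : 0 <= (if y == 0 then tail k n 0 else tail k.+1 n y) <= 1 by case: ifP.
by rewrite !avg_le// => y; case/andP: (H y).
Qed.

Lemma tail_leS k n x : tail k n x <= tail k n.+1 x.
Proof.
elim: n k x => [|n IH] [|k] x; rewrite ?tail0//.
  by rewrite tailS0; case/andP: (tail01 k.+1 1 x).
by rewrite (tailSS k n.+1) tailSS; apply: avg_le => y; case: ifP.
Qed.

Lemma tail_nd k x : nondecreasing_seq (fun n => tail k n x).
Proof. by apply/nondecreasing_seqP => n; exact: tail_leS. Qed.

Lemma tail_kS k n x : tail k.+1 n x <= tail k n x.
Proof.
elim: n k x => [|n IH] [|k] x; rewrite ?tail0//.
- by case/andP: (tail01 1 n.+1 x).
- by rewrite !tailSS; apply: avg_le => y; case: ifP.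
Qed.

Lemma tailS_avg k n x : tail k.+1 n.+1 x =
  avg (tail k.+1 n) x + (tail k n 0 - tail k.+1 n 0) * avg (at0 R) x.
Proof.
rewrite tailSS -avgZ -avgD; apply: eq_bigr => s _; congr (_ * _).
rewrite /at0; case: eqP => [->|_]; rewrite ?mulr1 ?mulr0 ?addr0//.
by rewrite addrC subrK.
Qed.

(** Each way of making at least k + 1 returns is decomposed according to the time
j + 1 of the return that is followed by exactly k others. *)
Lemma tail_renewal k n x : tail k.+1 n x =
  \sum_(j < n) visits j.+1 x * (tail k (n - j.+1) 0 - tail k.+1 (n - j.+1) 0).
Proof.
elim: n x => [|n IH] x; first by rewrite big_ord0.
rewrite tailS_avg big_ord_recl subn1/= [RHS]addrC [X in _ + X]mulrC; congr (_ + _).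
transitivity (avg (fun y => \sum_(j < n)
   (tail k (n - j.+1) 0 - tail k.+1 (n - j.+1) 0) * visits j.+1 y) x).
  by apply: eq_bigr => s _; rewrite IH; congr (_ * _); apply: eq_bigr => j _; rewrite mulrC.
by rewrite avg_sum; apply: eq_bigr => j _; rewrite mulrC.
Qed.

(** The generating functions G_k of the tails satisfy
G_(k+1) = z avg G_(k+1) + (G_k(0) - G_(k+1)(0)) z avg at0, while green minus at0
solves the same equation with source z avg at0. By uniqueness
G_(k+1)(0) = (G_k(0) - G_(k+1)(0)) (green z 0 - 1), a geometric recurrence. *)
Lemma discounted_tail k z : 0 <= z < 1 ->
  (1 - z) * discounted z (fun n => tail k n 0) = (1 - (green z 0)^-1) ^+ k.
Proof.
move=> z01; have /andP[z0 z1] := z01.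
have z1_neq0 : 1 - z != 0 by rewrite subr_eq0 gt_eqF.
have g_neq0 : green z 0 != 0 by rewrite gt_eqF// (lt_le_trans _ (green0_ge1 z01)).
pose G k x := discounted z (fun n => tail k n x).
rewrite -/(G k 0); elim: k => [|k IH].
  rewrite expr0 /G.
  have : G 0%N 0 = 1 + z * G 0%N 0.
    rewrite {1}/G discounted_rec//= ?tail0.
    + by rewrite /G; congr (_ + _ * discounted z _); apply/funext => n; rewrite !tail0.
    + by move=> n; exact: tail01.
  rewrite -/(G 0%N 0); lra.
have bnd k' x : 0 <= G k' x <= (1 - z)^-1.
  by rewrite discounted_ge0 ?discounted_le// => n; exact: tail01.
set c := G k 0 - G k.+1 0.
have GE x : G k.+1 x = z * avg (G k.+1) x + c * (z * avg (at0 R) x).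
  rewrite {1}/G discounted_rec//; last by move=> n; exact: tail01.
  rewrite tailS0 add0r mulrCA -mulrDr; congr (_ * _).
  pose h := fun (n : nat) => \sum_(s : steps S) step_prob s *
    (if x + val s == 0 then tail k n 0 else tail k.+1 n (x + val s)).
  rewrite (_ : (fun n => _) = h); last by apply/funext => n; rewrite tailSS.
  rewrite /h discounted_lincomb//; last by move=> s n; case: ifP => _; exact: tail01.
  rewrite -avgZ -avgD; apply: eq_bigr => s _; congr (_ * _).
  rewrite /at0; case: eqP => [->|_]; rewrite ?mulr1 ?mulr0 ?addr0//.
  by rewrite addrC subrK.
pose d x := G k.+1 x - c * (green z x - at0 R x).
have dE x : d x = z * avg d x.
  have -> : avg d x = avg (G k.+1) x - c * (avg (green z) x - avg (at0 R) x).
    by rewrite -avgB -avgZ -avgB.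
  rewrite /d GE (greenE x)//; ring.
have at0_01 x : `|at0 R x| <= 1.
  by rewrite /at0; case: eqP => _; rewrite ?normr1 ?normr0.
have d0 x : d x = 0.
  apply/eqP; rewrite -normr_le0 -[leRHS](mul0r (1 - z)^-1).
  apply: (@discounted_bound _ S _ _ _ ((1 - z)^-1 + `|c| * ((1 - z)^-1 + 1))) => //.
    move=> y; rewrite (le_trans (ler_normB _ _))// lerD//.
      by have /andP[? ?] := bnd k.+1 y; rewrite ger0_norm.
    rewrite normrM ler_wpM2l// (le_trans (ler_normB _ _))// lerD//.
    by rewrite ger0_norm ?green_ge0// green_le.
  by move=> y; rewrite dE subrr normr0.
have := d0 0; rewrite /d /at0 eqxx /c => /eqP; rewrite subr_eq0 => /eqP E.
rewrite exprS -IH mulrCA; congr (_ * _).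
apply: (mulfI g_neq0); rewrite mulrA mulrBr mulr1 divff//.
by move: E => /=; lra.
Qed.

End green_function.

Section law_of_returns.
Context (R : realType) (S : step_set R).
Implicit Types (x y : int) (n k : nat).

Definition returns_from x n (w : walk S n) : nat :=
  count (fun i => x + altitude w i == 0) (iota 1 n).

Definition walk_mass n (w : walk S n) : R := walk_weight w / step_poly S 1 ^+ n.

Definition wcons n (s : steps S) (w : walk S n) : walk S n.+1 := [tuple of s :: w].

Lemma sum_walkS n (F : walk S n.+1 -> R) :
  \sum_(w : walk S n.+1) F w = \sum_s \sum_(w : walk S n) F (wcons s w).
Proof.
rewrite pair_big/= (reindex (fun p : steps S * walk S n => wcons p.1 p.2))//=.
exists (fun w => (thead w, [tuple of behead w])) => [[s w]|w] _ /=.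
  by rewrite theadE; congr (_, _); apply: val_inj.
by rewrite /wcons/= -tuple_eta.
Qed.

Lemma walk_mass_cons n s (w : walk S n) : walk_mass (wcons s w) = step_prob s * walk_mass w.
Proof.
rewrite /walk_mass /walk_weight big_ord_recl tnth0 exprS invfM.
under eq_bigr do rewrite tnthS.
by rewrite /step_prob -!mulrA; congr (_ * _); rewrite mulrCA.
Qed.

Lemma altitude0 n (w : walk S n) : altitude w 0 = 0.
Proof. by rewrite /altitude take0 big_nil. Qed.

Lemma altitude_cons n s (w : walk S n) i :
  altitude (wcons s w) i.+1 = val s + altitude w i.
Proof. by rewrite /altitude /= big_cons. Qed.

Lemma returns_cons n s x (w : walk S n) :
  returns_from x (wcons s w) = ((x + val s == 0)%R + returns_from (x + val s)%R w)%N.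
Proof.
rewrite /returns_from/= altitude_cons altitude0 addr0; congr (_ + _)%N.
rewrite -[2%N]addn1 (iotaDl 1 1) count_map; apply: eq_count => i /=.
by rewrite add1n altitude_cons addrA.
Qed.

Lemma sum_walk_mass n : \sum_(w : walk S n) walk_mass w = 1.
Proof.
elim: n => [|n IH].
  rewrite (big_pred1 [tuple]) => [|w]; last by apply/esym/eqP; exact: tuple0.
  by rewrite /walk_mass /walk_weight big_ord0 expr0 divr1.
rewrite sum_walkS -[RHS](sum_step_prob S); apply: eq_bigr => s _.
under eq_bigr do rewrite walk_mass_cons.
by rewrite -mulr_sumr IH mulr1.
Qed.

Lemma prob_returns_ge k n x :
  \sum_(w : walk S n | (k <= returns_from x w)%N) walk_mass w = tail S k n x.
Proof.
elim: n k x => [|n IH] [|k] x; rewrite ?tail0 ?sum_walk_mass//.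
  by rewrite tailS0 big_pred0.
rewrite tailSS big_mkcond sum_walkS; apply: eq_bigr => s _.
under eq_bigr => w _ do rewrite returns_cons walk_mass_cons.
rewrite -big_mkcond -mulr_sumr; congr (_ * _).
by case: eqP => [->|_]; rewrite IH.
Qed.

Lemma prob_bridge n x :
  \sum_(w : walk S n | x + altitude w n == 0) walk_mass w = visits S n x.
Proof.
elim: n x => [|n IH] x.
  rewrite big_mkcond (big_pred1 [tuple]) => [|w]; last by apply/esym/eqP; exact: tuple0.
  rewrite altitude0 addr0 /visits/= /at0; case: ifP => //= _.
  by rewrite /walk_mass /walk_weight big_ord0 expr0 divr1.
rewrite visitsS big_mkcond sum_walkS; apply: eq_bigr => s _.
under eq_bigr => w _ do rewrite altitude_cons walk_mass_cons addrA.
by rewrite -big_mkcond -mulr_sumr IH.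
Qed.

Lemma bridge_weightE n :
  bridge_weight S n / step_poly S 1 ^+ n = visits S n 0.
Proof.
rewrite -prob_bridge /bridge_weight mulr_suml; apply: eq_bigl => w.
by rewrite add0r.
Qed.

Lemma walk_prob_returns_lt n k :
  walk_prob S n [set w | (returns_to_zero w < k)%N] = (1 - tail S k n 0)%:E.
Proof.
rewrite /walk_prob; congr EFin; rewrite -prob_returns_ge -[X in _ = X - _](sum_walk_mass n).
rewrite [X in _ = X - _](bigID (fun w => (k <= returns_from 0 w)%N))/= addrAC subrr add0r.
have rE (w : walk S n) : returns_from 0 w = returns_to_zero w.
  by apply: eq_count => i; rewrite add0r.
by apply: eq_bigl => w; rewrite rE -ltnNge; apply/idP/idP; rewrite inE.
Qed.

End law_of_returns.

(** * Derivatives of the step polynomial *)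

Section step_poly_derivative.
Context (R : realType) (S : step_set R).

Lemma is_derive_exprn n (u : R) :
  is_derive u 1 (fun t : R => t ^+ n) (n%:R * u ^+ n.-1).
Proof.
apply: DeriveDef; first exact: exprn_derivable.
by rewrite exp_derive /GRing.scale/= mulr1.
Qed.

Lemma is_derive_exprz (m : int) (u : R) : u != 0 ->
  is_derive u 1 (fun t : R => t ^ m) (m%:~R * u ^ (m - 1)).
Proof.
move=> u0; case: m => n.
  apply: is_derive_eq; first exact: (is_derive_exprn n u).
  case: n => [|n]; first by rewrite mul0r mulr0z mul0r.
  by rewrite /= (_ : n.+1%:Z - 1 = n); last lia.
apply: is_derive_eq.
  apply: is_deriveV; last exact: (is_derive_exprn n.+1 u).
  by rewrite expf_neq0.
have -> : (Negz n - 1 = - (n.+2%:Z)) by lia.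
rewrite NegzE mulrNz /GRing.scale/=.
have -> : u ^ (- n.+2%:Z) = (u ^+ n.+2)^-1 by [].
have un m : u ^+ m != 0 by rewrite expf_neq0.
rewrite !mulNr; congr (- _).
rewrite mulrCA; congr (_ * _).
apply/eqP; rewrite mulrC -[(u ^+ n.+2)^-1]mul1r eqr_div ?expf_neq0// mul1r -exprM -exprD.
by apply/eqP; congr (_ ^+ _); lia.
Qed.

Lemma is_derive_lincomb (I : Type) (r : seq I) (c : I -> R) (f : I -> R -> R)
    (df : I -> R) (u : R) : (forall i, is_derive u 1 (f i) (df i)) ->
  is_derive u 1 (fun t => \sum_(i <- r) c i * f i t) (\sum_(i <- r) c i * df i).
Proof.
move=> fdf; elim: r => [|i r IH].
  rewrite big_nil (_ : (fun _ => _) = cst 0); first exact: is_derive_cst.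
  by apply/funext => t; rewrite big_nil.
rewrite big_cons (_ : (fun _ => _) =
  (c i \*: f i) + (fun t => \sum_(j <- r) c j * f j t)); first exact: is_deriveD.
by apply/funext => t; rewrite big_cons.
Qed.

Lemma is_derive_step_poly (u : R) : u != 0 -> is_derive u 1 (step_poly S)
  (\sum_(s : steps S) step_weight s * ((val s)%:~R * u ^ (val s - 1))).
Proof. by move=> u0; apply: is_derive_lincomb => s; exact: is_derive_exprz. Qed.

Lemma step_poly_derive1 : derive1 (step_poly S) 1 =
  \sum_(s : steps S) step_weight s * (val s)%:~R.
Proof.
rewrite derive1E; have /@derive_val -> := is_derive_step_poly (oner_neq0 R).
by apply: eq_bigr => s _; rewrite exp1rz mulr1.
Qed.

Lemma step_poly_derive2 : derive1n 2 (step_poly S) 1 =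
  \sum_(s : steps S) step_weight s * ((val s)%:~R * (val s - 1)%:~R).
Proof.
rewrite /derive1n/= derive1E.
have D : is_derive (1 : R) 1
    (fun u : R => \sum_(s : steps S) step_weight s * (val s)%:~R * u ^ (val s - 1))
    (\sum_(s : steps S) step_weight s * (val s)%:~R *
      ((val s - 1)%:~R * 1 ^ (val s - 1 - 1))).
  by apply: is_derive_lincomb => s; apply: is_derive_exprz; exact: oner_neq0.
transitivity ('D_1 (fun u : R => \sum_(s : steps S) step_weight s * (val s)%:~R * u ^ (val s - 1)) (1 : R)).
  apply: near_eq_derive; near=> u; rewrite derive1E.
  have u0 : u != 0.
    by rewrite gt_eqF//; near: u; exact: lt_nbhsr ltr01.
  have /@derive_val -> := is_derive_step_poly u0.
  by apply: eq_bigr => s _; rewrite mulrA.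
rewrite derive_val; apply: eq_bigr => s _.
by rewrite exp1rz mulr1 mulrA.
Unshelve. all: by end_near. Qed.

End step_poly_derivative.

(** * Transience under a non-zero drift *)

Section transient.
Context (R : realType) (S : step_set R).

(** Otherwise 1 would minimize P on the positive half-line, and be critical. *)
Lemma exists_step_poly_lt : derive1 (step_poly S) 1 != 0 ->
  exists2 u : R, 0 < u & step_poly S u < step_poly S 1.
Proof.
move=> D; apply: contrapT => noU; move/negP: D; apply.
have Pge (u : R) : 0 < u -> step_poly S 1 <= step_poly S u.
  by move=> u0; rewrite leNgt; apply/negP => ?; apply: noU; exists u.
have : is_derive (1 : R) 1 (step_poly S) 0.
  apply: (@derive1_at_min _ _ 0 2); first exact: ler0n.
  - move=> t; rewrite in_itv/= => /andP[t0 _].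
    by have [] := is_derive_step_poly S (lt0r_neq0 t0).
  - by rewrite in_itv/= ltr01 ltr1n.
  - by move=> t; rewrite in_itv/= => /andP[t0 _]; exact: Pge.
by rewrite derive1E => /@derive_val ->.
Qed.

Lemma avg_exprz (u : R) x : u != 0 ->
  avg S (fun y => u ^ y) x = u ^ x * (step_poly S u / step_poly S 1).
Proof.
move=> u0; rewrite /avg mulr_suml mulr_sumr; apply: eq_bigr => s _.
by rewrite expfzDr// /step_prob; ring.
Qed.

(** Exponential change of measure: y -> u ^ y is an eigenfunction of the
averaging operator and dominates the indicator of 0. *)
Lemma visits_le_exp (u : R) n x : 0 < u ->
  visits S n x <= u ^ x * (step_poly S u / step_poly S 1) ^+ n.
Proof.
move=> u0; elim: n x => [|n IH] x.
  by rewrite expr0 mulr1 /visits/= /at0; case: eqP => [->|_]; rewrite ?expr0z ?exprz_ge0// ltW.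
rewrite visitsS (le_trans (avg_le S x IH))// exprS mulrA -avg_exprz ?gt_eqF//.
rewrite [leRHS]mulrC -avgZ le_eqVlt; apply/orP; left; apply/eqP.
by apply: eq_bigr => s _; congr (_ * _); exact: mulrC.
Qed.

Lemma summable_visits : derive1 (step_poly S) 1 != 0 ->
  cvgn (series (fun n => visits S n 0)).
Proof.
move=> /exists_step_poly_lt[u u0 Pu].
set rho := step_poly S u / step_poly S 1.
have rho0 : 0 <= rho.
  rewrite divr_ge0//; last exact/ltW/step_poly1_gt0.
  by apply: sumr_ge0 => s _; rewrite mulr_ge0 ?exprz_ge0// ltW ?step_weight_gt0.
apply: (@series_le_cvg _ _ (geometric 1 rho)).
- by move=> n; exact: visits_ge0.
- by move=> n; rewrite /= mul1r exprn_ge0.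
- by move=> n; rewrite /= mul1r (le_trans (visits_le_exp n 0 u0))// expr0z mul1r.
- apply: is_cvg_geometric_series; rewrite ger0_norm//.
  by rewrite ltr_pdivrMr ?mul1r ?step_poly1_gt0.
Qed.

Lemma bridge_gfE : bridge_gf S (1 / step_poly S 1) = limn (series (fun n => visits S n 0)).
Proof.
rewrite /bridge_gf; congr (limn (series _)); apply/funext => n.
by rewrite /= -bridge_weightE expr_div_n expr1n div1r.
Qed.

End transient.

Section convolution.
Context (R : realType).
Implicit Types (q D : nat -> R).

(** The terms with j far from n involve values of D close to its limit, and the
terms with j close to n carry a vanishing part of the mass of q. *)
Lemma cvg_convolution q D (Q d M : R) : (forall n, 0 <= q n) ->
  series q @ \oo --> Q -> (forall n, `|D n| <= M) -> D @ \oo --> d ->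
  (fun n => \sum_(j < n) q j * D (n - j.+1)%N) @ \oo --> Q * d.
Proof.
move=> q0 qQ DM Dd.
have Sd : (fun n => series q n * d) @ \oo --> Q * d.
  by apply: cvgM qQ _; exact: cvg_cst.
suff: (fun n => (\sum_(j < n) q j * D (n - j.+1)%N) - series q n * d) @ \oo --> (0 : R).
  move=> /cvgD - /(_ _ _ Sd); rewrite add0r; apply: cvg_trans.
  by apply: near_eq_cvg; apply: nearW => n; rewrite subrK.
have M0 : 0 <= M by exact: le_trans (DM 0%N).
have Q0 : 0 <= Q.
  rewrite -(cvg_lim (@Rhausdorff R) qQ); apply: limr_ge; first exact/cvgP/qQ.
  by apply: nearW => n; exact: sumr_ge0.
have nd : nondecreasing_seq (series q) by apply: nondecreasing_series.
have qle n : series q n <= Q.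
  by rewrite -(cvg_lim (@Rhausdorff R) qQ); apply: nondecreasing_cvgn_le => //; exact/cvgP/qQ.
have dM : `|d| <= M.
  rewrite -(cvg_lim (@Rhausdorff R) (cvg_norm Dd)); apply: limr_le.
    exact/cvgP/(cvg_norm Dd).
  exact: nearW.
apply/cvgrPdist_le => e e0.
have e1 : 0 < e / 2 / (Q + 1) by rewrite !divr_gt0// ltr_wpDl.
have e2 : 0 < e / 2 / (M + M + 1).
  by rewrite !divr_gt0// ltr_wpDl// addr_ge0.
have [N _ HN] : \forall n \near \oo, `|d - D n| <= e / 2 / (Q + 1).
  by move/cvgrPdist_le : Dd; apply.
have [K _ HK] : \forall n \near \oo, `|Q - series q n| <= e / 2 / (M + M + 1).
  by move/cvgrPdist_le : qQ; apply.
exists (N + K)%N => // n /= nNK.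
rewrite sub0r normrN seriesEord/= mulr_suml -sumrB.
apply: le_trans (ler_norm_sum _ _ _) _.
apply: (@le_trans _ _ (\sum_(j < n) q j * (if (j < n - N)%N then e / 2 / (Q + 1) else M + M))).
  apply: ler_sum => j _; rewrite -mulrBr normrM ger0_norm// ler_wpM2l//.
  case: ifPn => [jn|_].
    by rewrite distrC; apply: HN => /=; lia.
  by rewrite (le_trans (ler_normB _ _))// lerD.
rewrite -(big_mkord xpredT (fun j => q j * (if (j < n - N)%N then _ else _))).
rewrite (@big_cat_nat _ _ _ (n - N))//=; last exact: leq_subr.
rewrite [leRHS](splitr e); apply: lerD.
  apply: (@le_trans _ _ (series q (n - N)%N * (e / 2 / (Q + 1)))).
    by rewrite /series/= mulr_suml big_nat_cond [leRHS]big_nat_cond; apply: ler_sum => j /andP[/andP[_ ->]].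
  rewrite mulrCA mulrA ler_pdivrMr ?ltr_wpDl// ler_wpM2l//.
    by rewrite divr_ge0// ltW.
  by rewrite (le_trans (qle _))// lerDl.
apply: (@le_trans _ _ ((series q n - series q (n - N)%N) * (M + M))).
  rewrite sub_series_geq ?leq_subr// mulr_suml big_nat_cond [leRHS]big_nat_cond.
  by apply: ler_sum => j /andP[/andP[nj _] _]; rewrite ltnNge nj.
have := HK (n - N)%N; rewrite /= => /(_ ltac:(lia)).
rewrite ger0_norm ?subr_ge0// => HQ.
apply: (@le_trans _ _ (e / 2 / (M + M + 1) * (M + M))).
  rewrite ler_wpM2r ?addr_ge0// (le_trans _ HQ)// lerD2r//.
rewrite -mulrA ler_piMr//; first by rewrite divr_ge0// ltW.
rewrite mulrC ler_pdivrMr ?mul1r ?lerDl//.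
by rewrite ltr_wpDl// addr_ge0.
Qed.

End convolution.

(** * The geometric limit law *)

Section returns_distribution.
Context (R : realType) (S : step_set R).

Lemma prob_returns_lt n k (A : set (walk S n)) :
  (forall w, A w <-> (returns_to_zero w < k)%N) ->
  walk_prob S n A = (1 - tail S k n 0)%:E.
Proof.
move=> AE; rewrite -walk_prob_returns_lt; congr walk_prob.
by apply/seteqP; split => w /AE.
Qed.

Lemma cvg_sum_visitsS (B : R) : series (fun n => visits S n 0) @ \oo --> B ->
  series (fun n => visits S n.+1 0) @ \oo --> B - 1.
Proof.
have visits0 : visits S 0 0 = 1 by rewrite /visits/= /at0 eqxx.
rewrite -cvg_shiftS => BE.
rewrite (_ : series _ = fun n => series (fun n => visits S n 0) n.+1 - 1).
  by apply: cvgB => //; exact: cvg_cst.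
apply/funext => n; rewrite /series/=.
by rewrite big_nat_recl// visits0 addrAC subrr add0r.
Qed.

Lemma sum_visits_ge1 (B : R) : series (fun n => visits S n 0) @ \oo --> B ->
  1 <= B.
Proof.
move=> /cvg_sum_visitsS qE; rewrite -subr_ge0 -(cvg_lim (@Rhausdorff R) qE).
apply: limr_ge; first exact: (cvgP _ qE).
by apply: nearW => n; apply: sumr_ge0 => i _; exact: visits_ge0.
Qed.

(** In the limit the renewal identity reads v = (B - 1) (v_k - v), where v_k and v
are the limits of the tails of orders k and k + 1. *)
Lemma cvg_tail_transient k : cvgn (series (fun n => visits S n 0)) ->
  (fun n => tail S k n 0) @ \oo -->
    (1 - (limn (series (fun n => visits S n 0)))^-1) ^+ k.
Proof.
move=> cB; set B := limn _.
have BE : series (fun n => visits S n 0) @ \oo --> B by [].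
have qE := cvg_sum_visitsS BE.
have B1 := sum_visits_ge1 BE.
elim: k => [|k IH].
  rewrite expr0 (_ : (fun n => _) = cst 1); first exact: cvg_cst.
  by apply/funext => n; rewrite tail0.
have ck : cvgn (fun n => tail S k.+1 n 0).
  apply: nondecreasing_is_cvgn; first exact: tail_nd.
  by exists 1 => _ [n _ <-]; case/andP: (tail01 S k.+1 n 0).
set v := limn (fun n => tail S k.+1 n 0) in ck.
have cv : (fun n => tail S k.+1 n 0) @ \oo --> v by [].
have bndP n : `|tail S k n 0 - tail S k.+1 n 0| <= 1.
  rewrite ger0_norm ?subr_ge0 ?tail_kS// lerBlDr.
  have /andP[_ t1] := tail01 S k n 0; rewrite (le_trans t1)// lerDl.
  by case/andP: (tail01 S k.+1 n 0).
have vE : v = (B - 1) * ((1 - B^-1) ^+ k - v).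
  apply: (@cvg_lim _ (@Rhausdorff R)).
  rewrite (_ : (fun n => _) = (fun n => \sum_(j < n) visits S j.+1 0 *
      (tail S k (n - j.+1) 0 - tail S k.+1 (n - j.+1) 0))).
    apply: (cvg_convolution (q := fun n => visits S n.+1 0)
      (D := fun n => tail S k n 0 - tail S k.+1 n 0)) qE bndP _.
      by move=> n; exact: visits_ge0.
    exact: cvgB.
  by apply/funext => n; rewrite tail_renewal.
suff -> : (1 - B^-1) ^+ k.+1 = v by [].
have B0 : B != 0 by rewrite gt_eqF// (lt_le_trans ltr01).
rewrite exprS; apply: (mulfI B0); rewrite mulrA mulrBr mulr1 divff//.
by move: vE; lra.
Qed.

Lemma geometric_cdf_ge0 (lambda x : R) : 0 < lambda <= 1 -> 0 <= x ->
  geometric_prob lambda `]-oo, x]%classic =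
    (1 - (1 - lambda) ^+ (Num.truncn x).+1)%:E.
Proof.
move=> l01 x0; rewrite /geometric_prob l01.
have -> : [set k : nat | `]-oo, x]%classic k%:R] = `I_(Num.truncn x).+1.
  apply/seteqP; split => k /=; rewrite in_itv/= ltnS truncn_ge_nat//.
have /andP[l0 l1] := l01.
rewrite esum_fset//; last first.
  by move=> k _; rewrite lee_fin mulr_ge0 ?exprn_ge0 ?subr_ge0// ltW.
rewrite -fsbig_ord sumEFin; congr EFin.
have := geometric_seriesE lambda (_ : 1 - lambda != 1).
rewrite -subr_eq0 addrAC subrr add0r oppr_eq0 gt_eqF// => /(_ isT)/(congr1 (@^~ (Num.truncn x).+1)).
rewrite seriesEord/= => ->.
by rewrite subKr mulrAC divff ?mul1r// gt_eqF.
Qed.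

Lemma geometric_cdf_lt0 (lambda x : R) : 0 < lambda <= 1 -> x < 0 ->
  geometric_prob lambda `]-oo, x]%classic = 0%:E.
Proof.
move=> l01 x0; rewrite /geometric_prob l01.
rewrite (_ : [set k | _] = set0) ?esum_set0//.
apply/seteqP; split => k //=; rewrite in_itv/= => kx.
by have := lt_le_trans x0 (le_trans (ler0n R k) (le_refl _)); rewrite ltNge (le_trans _ kx).
Qed.

Lemma returns_geometric : derive1 (step_poly S) 1 != 0 ->
  cvg_in_law (walk_prob S) (num_returns S)
    (geometric_prob (1 / bridge_gf S (1 / step_poly S 1))).
Proof.
move=> /summable_visits cB; rewrite bridge_gfE; set B := limn _.
have B1 : 1 <= B by apply: sum_visits_ge1 cB.
have l01 : 0 < 1 / B <= 1.
  by rewrite div1r invr_gt0 invf_le1 ?B1 ?andbT ?(lt_le_trans ltr01).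
move=> x /= _; have [x0|x0] := ltP x 0.
  rewrite geometric_cdf_lt0//; apply: cvg_near_cst; apply: nearW => n.
  rewrite /cdf /distribution /pushforward (@prob_returns_lt n 0)//=.
    by rewrite tail0 subrr.
  move=> w; rewrite ltn0 in_itv/=; split => // wx.
  by have := le_lt_trans wx x0; rewrite ltNge ler0n.
rewrite geometric_cdf_ge0//.
rewrite (_ : (fun n => _) = EFin \o (fun n => 1 - tail S (Num.truncn x).+1 n 0)).
  apply: cvg_EFin; first exact: nearW.
  rewrite (_ : 1 - 1 / B = 1 - B^-1) ?div1r//.
  by apply: cvgB; [exact: cvg_cst|exact: cvg_tail_transient].
apply/funext => n /=; rewrite /cdf /distribution /pushforward.
apply: prob_returns_lt => w; rewrite /= in_itv/= /num_returns.
by rewrite ltnS truncn_ge_nat.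
Qed.

End returns_distribution.

(** * Reachability and ratios of the Green function *)

Section reachability.
Context (R : realType) (S : step_set R).
Implicit Types (a b : int).

Definition reachable a := exists l : seq (steps S), a = \sum_(s <- l) val s.

Lemma reachable0 : reachable 0.
Proof. by exists [::]; rewrite big_nil. Qed.

Lemma reachable_step (s : steps S) : reachable (val s).
Proof. by exists [:: s]; rewrite big_seq1. Qed.

Lemma reachableD a b : reachable a -> reachable b -> reachable (a + b).
Proof. by move=> [l ->] [m ->]; exists (l ++ m); rewrite big_cat. Qed.

Lemma reachableMn a n : reachable a -> reachable (a *+ n).
Proof.
move=> ra; elim: n => [|n IH]; first by rewrite mulr0n; exact: reachable0.
by rewrite mulrS; exact: reachableD.
Qed.

(** If t is a step of sign opposite to s, then |t| copies of s and |s| copies of t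
sum up to 0. *)
Lemma reachable_stepN (s : steps S) : reachable (- val s).
Proof.
have [t t0] := has_neg_step S; have [u u0] := has_pos_step S.
have [s0|s0|s0] := ltgtP (val s) 0.
- have -> : - val s = val u *+ absz (val s) + val s *+ (absz (val u)).-1.
    rewrite -mulr_natr -[val s *+ _]mulr_natr !natz.
    have -> : (absz (val s))%:Z = - val s by lia.
    have -> : (absz (val u)).-1%:Z = val u - 1 by lia.
    by ring.
  by apply: reachableD; apply: reachableMn; exact: reachable_step.
- have -> : - val s = val t *+ absz (val s) + val s *+ (absz (val t)).-1.
    rewrite -mulr_natr -[val s *+ _]mulr_natr !natz.
    have -> : (absz (val s))%:Z = val s by lia.
    have -> : (absz (val t)).-1%:Z = - val t - 1 by lia.
    by ring.
  by apply: reachableD; apply: reachableMn; exact: reachable_step.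
- by rewrite s0 oppr0; exact: reachable0.
Qed.

Lemma reachableN a : reachable a -> reachable (- a).
Proof.
move=> [l ->]; elim: l => [|s l IH].
  by rewrite big_nil oppr0; exact: reachable0.
by rewrite big_cons opprD; apply: reachableD => //; exact: reachable_stepN.
Qed.

Lemma reachableMz a m : reachable a -> reachable (m * a).
Proof.
move=> ra; case: (intP m) => [|n|n]; first by rewrite mul0r; exact: reachable0.
  by rewrite -natz mulr_natl; exact: reachableMn.
by rewrite mulNr -natz mulr_natl; exact/reachableN/reachableMn.
Qed.

Lemma periodic_dvd (d : nat) : (1 < d)%N ->
  (forall s : steps S, (d %| val s)%Z) -> Defs.periodic S.
Proof.
move=> d1 dS; have d0 : d%:Z != 0 by rewrite eqz_nat; lia.
pose N := (\sum_(s : steps S) absz (val s))%N.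
have sN (s : steps S) : (absz (val s) <= N)%N by rewrite /N (bigD1 s)//= leq_addr.
pose e (s : steps S) := absz ((val s %/ d)%Z + N).
have eE (s : steps S) : (e s)%:Z * d = val s + (N * d)%N.
  have qd := divzK (dS s); rewrite /e; set q := (val s %/ d)%Z in qd *.
  have qN : (absz q <= N)%N.
    by rewrite (leq_trans _ (sN s))// -qd abszM /= leq_pmulr//; lia.
  by rewrite gez0_abs ?mulrDl ?qd ?PoszM//; lia.
exists (\sum_(s : steps S) step_weight s *: 'X^(e s)), (- (N * d)%N%:Z), d.
split=> // u u0; rewrite horner_sum mulr_sumr; apply: eq_bigr => s _.
rewrite hornerZ hornerXn -exprM mulrCA; congr (_ * _).
rewrite -[u ^+ _]/(u ^ (_ %:Z)) -expfzDr//; congr (_ ^ _).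
by have := eE s; lia.
Qed.

(** The reachable altitudes form a subgroup of the integers, generated by its
least positive element d, and d divides all the steps. *)
Lemma aperiodic_reachable a : aperiodic S -> reachable a.
Proof.
move=> aper.
have exP : exists n, (0 < n)%N && `[< reachable n%:Z >].
  have [s s0] := has_pos_step S; exists (absz (val s)).
  rewrite absz_gt0 gt_eqF//=; apply/asboolP; rewrite gtz0_abs//.
  exact: reachable_step.
have [d /andP[d0 /asboolP rd] dmin] := ex_minnP exP.
have ddvd b : reachable b -> (d %| b)%Z.
  move=> rb; apply/dvdz_mod0P/eqP; apply: contrapT => /negP m0.
  have m_ge0 : 0 <= (b %% d)%Z by rewrite modz_ge0//; lia.
  have m_lt : (b %% d)%Z < d by rewrite ltz_pmod.
  have := dmin (absz (b %% d)%Z); rewrite absz_gt0 m0/= => /(_ _).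
  suff rm : reachable (absz (b %% d)%Z)%:Z.
    by move=> /(_ (asboolT rm)); lia.
  rewrite gez0_abs// /modz; apply: reachableD => //.
  by apply/reachableN/reachableMz.
have d1 : d = 1%N.
  apply/eqP; rewrite eqn_leq d0 andbT leqNgt; apply/negP => d1; apply: aper.
  by apply: (periodic_dvd d1) => s; apply/ddvd/reachable_step.
have -> : a = a * d%:Z by rewrite d1 mulr1.
exact: reachableMz.
Qed.

End reachability.

Section green_ratio.
Context (R : realType) (S : step_set R) (z : nat -> R).
Context (z01 : forall n, 0 <= z n < 1).

(** Propagation of the maximum. The ratio is at most 1, equals 1 at 0, and its
value at y exceeds its average over the neighbours y + s by at most 1 / green z 0.
Hence if it tends to 1 at y, it tends to 1 at each y + s. *)
Lemma cvg_green_ratio x : (fun n => (green S (z n) 0)^-1) @ \oo --> (0 : R) ->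
  reachable S x ->
  (fun n => green S (z n) x / green S (z n) 0) @ \oo --> (1 : R).
Proof.
move=> G0 [l ->].
have Gp n : 0 < green S (z n) 0 by apply: lt_le_trans (green0_ge1 S (z01 n)).
elim/last_ind: l => [|l s IH].
  rewrite big_nil (_ : (fun n => _) = cst 1); first exact: cvg_cst.
  by apply/funext => n; rewrite divff// gt_eqF.
rewrite big_rcons/=.
set y := \sum_(i <- l) _ in IH *.
apply: (@squeeze_cvgr _ _ _ _
  (fun n => 1 - ((green S (z n) 0)^-1 + (1 - green S (z n) y / green S (z n) 0)) / step_prob s) (cst 1)).
- apply: nearW => n; apply/andP; split; last first.
    by rewrite ler_pdivrMr// mul1r green_max.
  rewrite lerBlDl -lerBlDr ler_pdivlMr ?step_prob_gt0//.
  have /andP[z0 z1] := z01 n.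
  rewrite (greenE S y (z01 n)).
  have p1 : \sum_(t | t != s) step_prob t = 1 - step_prob s.
    by rewrite -(sum_step_prob S) [in RHS](bigD1 s)//= addrAC subrr add0r.
  have le1 : at0 R y + z n * avg S (green S (z n)) y <=
    1 + (step_prob s * green S (z n) (y + val s) + (1 - step_prob s) * green S (z n) 0).
    apply: lerD; first by rewrite /at0; case: eqP => _; rewrite ?lexx ?ler01.
    apply: (@le_trans _ _ (avg S (green S (z n)) y)).
      apply: ler_piMl; last exact: ltW.
      by rewrite -(avg_cst S 0 y); apply: avg_le => t; exact: green_ge0.
    rewrite /avg (bigD1 s)//= lerD2l -p1 mulr_suml; apply: ler_sum => t _.
    by rewrite ler_wpM2l ?step_prob_ge0// green_max.
  have GG : green S (z n) 0 * (green S (z n) 0)^-1 = 1 by rewrite divff// gt_eqF.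
  have g0 : 0 <= (green S (z n) 0)^-1 by rewrite invr_ge0 ltW.
  move: le1 => /(ler_wpM2r g0).
  move: (at0 R y + _) (green S (z n) (y + _)) (green S (z n) 0) (green S (z n) 0)^-1 (step_prob s) GG.
  move=> u q G g p Gg.
  have : (1 - p) * G * g = 1 - p by rewrite -mulrA Gg mulr1.
  by lra.
- rewrite [X in _ --> X](_ : _ = 1 - (0 + (1 - 1)) / step_prob s); last first.
    by rewrite subrr addr0 mul0r subr0.
  apply: cvgB; first exact: cvg_cst.
  apply: cvgM; last exact: cvg_cst.
  by apply: cvgD => //; apply: cvgB => //; exact: cvg_cst.
- exact: cvg_cst.
Qed.

End green_ratio.

(** * Second-order expansion of the exponential *)

Section exponential_expansion.
Context (R : realType).
Implicit Types (t c : R) (f g : R -> R).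

Lemma le_of_derive_ge0 f (df : R -> R) (s t : R) : s <= t ->
  (forall u : R, s <= u <= t -> is_derive u 1 f (df u)) ->
  (forall u, s <= u <= t -> 0 <= df u) -> f s <= f t.
Proof.
move=> st fdf df0.
have [c cst E] : exists2 c, c \in `[s, t]%R & f t - f s = df c * (t - s).
  apply: (MVT_segment st) => [u|].
    by rewrite in_itv/= => /andP[su ut]; apply: fdf; rewrite !ltW.
  apply: derivable_within_continuous => u; rewrite in_itv/= => sut.
  by have [] := fdf u sut.
by rewrite -subr_ge0 E mulr_ge0 ?subr_ge0// df0.
Qed.

(** exp t - 1 - t lies between t ^ 2 / 2 and exp t times t ^ 2 / 2, in an order that
depends on the sign of t: the differences g and k are nondecreasing and vanish
at 0. *)
Lemma expR_taylor2 t : `|expR t - 1 - t - t ^+ 2 / 2| <= t ^+ 2 / 2 * `|expR t - 1|.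
Proof.
pose g (u : R) := expR u - 1 - u - u ^+ 2 / 2.
pose k (u : R) := u ^+ 2 / 2 * expR u - expR u + 1 + u.
have dg : {homo g : x y / x <= y}.
  move=> y1 y2 y12; apply: (@le_of_derive_ge0 _ (fun u => expR u - 1 - u)) => // u _.
    by apply: is_derive_eq; rewrite /GRing.scale/=; field.
  by rewrite -addrA -opprD subr_ge0 expR_ge1Dx.
have dk : {homo k : x y / x <= y}.
  move=> y1 y2 y12; apply: (@le_of_derive_ge0 _
    (fun u => expR u * (expR (- u) - 1 + u + u ^+ 2 / 2))) => // u _.
    apply: is_derive_eq; rewrite /GRing.scale/=.
    have := expRxMexpNx_1 u; move: (expR (- u)) (expR u) => a b ba.
    by rewrite !mulrDr ba; field.
  rewrite mulr_ge0 ?expR_ge0// addr_ge0 ?divr_ge0 ?sqr_ge0//.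
  by have := expR_ge1Dx (- u); lra.
have g0 : g 0 = 0 by rewrite /g expR0 expr0n/=; lra.
have k0 : k 0 = 0 by rewrite /k expR0 expr0n/=; lra.
have [t0|/ltW t0] := leP 0 t.
  have := dg _ _ t0; have := dk _ _ t0; rewrite g0 k0 /g /k => H1 H2.
  have e0 : 0 <= expR t - 1 by have := expR_ge1Dx t; lra.
  by rewrite !ger0_norm//; lra.
have := dg _ _ t0; have := dk _ _ t0; rewrite g0 k0 /g /k => H1 H2.
have e0 : expR t - 1 <= 0 by rewrite subr_le0 expR_le1.
by rewrite !ler0_norm//; lra.
Qed.

Context (a : nat -> R).
Context (a0 : a @ \oo --> (0 : R)).
Context (a_neq0 : forall n, a n != 0).

Lemma cvg_expR_taylor2 c :
  (fun n => (expR (c * a n) - 1 - c * a n) / a n ^+ 2) @ \oo --> c ^+ 2 / 2.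
Proof.
have ca0 : (fun n => c * a n) @ \oo --> (0 : R).
  by rewrite -[X in _ --> X](mulr0 c); apply: cvgM => //; exact: cvg_cst.
have e0 : (fun n => c ^+ 2 / 2 * `|expR (c * a n) - 1|) @ \oo --> (0 : R).
  rewrite [X in _ --> X](_ : _ = c ^+ 2 / 2 * `|expR 0 - 1|); last first.
    by rewrite expR0 subrr normr0 mulr0.
  apply: cvgM; first exact: cvg_cst.
  apply: cvg_norm; apply: cvgB; last exact: cvg_cst.
  by apply: continuous_cvg => //; exact: continuous_expR.
apply/cvgrPdist_le => e e_gt0.
move/cvgrPdist_le : e0 => /(_ e e_gt0); apply: filterS => n.
rewrite sub0r normrN ger0_norm; last first.
  by apply: mulr_ge0 => //; apply: divr_ge0 => //; exact: sqr_ge0.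
move=> He; apply: le_trans He.
have an2 : 0 < a n ^+ 2 by rewrite exprn_even_gt0//= a_neq0.
have -> : c ^+ 2 / 2 - (expR (c * a n) - 1 - c * a n) / a n ^+ 2 =
    - (expR (c * a n) - 1 - c * a n - (c * a n) ^+ 2 / 2) / a n ^+ 2.
  by field; exact: a_neq0.
rewrite normrM normrN normfV (gtr0_norm an2) ler_pdivrMr//.
by rewrite (le_trans (expR_taylor2 _))// exprMn; lra.
Qed.

Lemma cvg_expR_taylor1 c :
  (fun n => (expR (c * a n) - 1) / a n) @ \oo --> c.
Proof.
rewrite (_ : (fun n => _) =
    fun n => c + (expR (c * a n) - 1 - c * a n) / a n ^+ 2 * a n); last first.
  by apply/funext => n; field; exact: a_neq0.
rewrite [X in _ --> X](_ : _ = c + c ^+ 2 / 2 * 0); last by rewrite mulr0 addr0.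
by apply: cvgD; [exact: cvg_cst|apply: cvgM a0; exact: cvg_expR_taylor2].
Qed.

End exponential_expansion.

(** * The Green function near the critical point *)

Section shifted_absolute_values.
Implicit Types (K m : nat).

(** Shifting the window by one more unit exchanges the end term K - m for
K + 1 + m, and so adds 2 m + 1 to the sum. *)
Lemma sum_abs_shift_nat K m : (m <= K)%N ->
  \sum_(i < K.*2.+1) `|i%:Z - K%:Z + m%:Z| =
  \sum_(i < K.*2.+1) `|i%:Z - K%:Z| + m%:Z ^+ 2.
Proof.
elim: m => [|m IH] mK.
  by rewrite expr0n addr0; apply: eq_bigr => i _; rewrite addr0.
have IHm := IH (ltnW mK).
pose F (i : nat) : int := `|i%:Z - K%:Z + m%:Z|.
have E : \sum_(i < K.*2.+1) `|i%:Z - K%:Z + m.+1%:Z| = \sum_(i < K.*2.+1) F i.+1.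
  by apply: eq_bigr => i _; rewrite /F; congr `|_|; lia.
have H : F 0%N + \sum_(i < K.*2.+1) F i.+1 = \sum_(i < K.*2.+1) F i + F K.*2.+1.
  rewrite [RHS](_ : _ = \sum_(i < K.*2.+2) F i); last by rewrite [RHS]big_ord_recr.
  by rewrite [RHS]big_ord_recl.
move: H; rewrite E {1 3 4}/F IHm.
rewrite (_ : `|0%:Z - K%:Z + m%:Z| = K%:Z - m%:Z); last by lia.
rewrite (_ : `|K.*2.+1%:Z - K%:Z + m%:Z| = K%:Z + 1 + m%:Z); last by lia.
rewrite (_ : m.+1%:Z = m%:Z + 1); last by lia.
by rewrite sqrrD mulr1 expr1n mulr2n; lia.
Qed.

Lemma sum_abs_shift K (s : int) : (absz s <= K)%N ->
  \sum_(i < K.*2.+1) `|i%:Z - K%:Z + s| =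
  \sum_(i < K.*2.+1) `|i%:Z - K%:Z| + s ^+ 2.
Proof.
have [s0|s0] := leP 0 s => sK.
  by rewrite -(gez0_abs s0) sum_abs_shift_nat.
rewrite (reindex_inj rev_ord_inj)/=.
have -> : s ^+ 2 = (absz s)%:Z ^+ 2 by rewrite -sqrrN; congr (_ ^+ _); lia.
rewrite -sum_abs_shift_nat//; apply: eq_bigr => i _.
by rewrite -normrN; congr `|_|; have := ltn_ord i; lia.
Qed.

Lemma sum_abs_shiftR (R : realType) K (s : int) : (absz s <= K)%N ->
  \sum_(i < K.*2.+1) (`|i%:Z - K%:Z + s|%:~R : R) =
  \sum_(i < K.*2.+1) `|i%:Z - K%:Z|%:~R + s%:~R ^+ 2.
Proof.
move=> /sum_abs_shift/(congr1 (fun m : int => m%:~R : R)).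
by rewrite intrD !rmorph_sum/= rmorphXn.
Qed.

End shifted_absolute_values.

Section green_asymptotics.
Context (R : realType) (S : step_set R) (z : nat -> R).
Context (z01 : forall n, 0 <= z n < 1).
Context (z_cvg1 : z @ \oo --> (1 : R)).
Context (mean0 : \sum_(s : steps S) step_prob s * (val s)%:~R = 0).
Context (all_reachable : forall x, reachable S x).

Let v : R := \sum_(s : steps S) step_prob s * (val s)%:~R ^+ 2.

Lemma step_variance_gt0 : 0 < v.
Proof.
have [s s0] := has_neg_step S; rewrite /v (bigD1 s)//= ltr_pwDl//.
  rewrite mulr_gt0 ?step_prob_gt0// exprn_even_gt0//=.
  by rewrite intr_eq0 lt_eqF.
by apply: sumr_ge0 => t _; rewrite mulr_ge0 ?step_prob_ge0 ?sqr_ge0.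
Qed.

Let a n : R := Num.sqrt (2 * (1 - z n) / v).

Let r_gt0 n : 0 < 1 - z n.
Proof. by rewrite subr_gt0; case/andP: (z01 n). Qed.

Let a2 n : a n ^+ 2 = 2 * (1 - z n) / v.
Proof. by rewrite sqr_sqrtr// divr_ge0 ?mulr_ge0 ?ltW ?step_variance_gt0. Qed.

Let a_gt0 n : 0 < a n.
Proof. by rewrite sqrtr_gt0 divr_gt0 ?mulr_gt0 ?step_variance_gt0. Qed.

Let r_cvg0 : (fun n => 1 - z n) @ \oo --> (0 : R).
Proof. by rewrite -(subrr (1:R)); apply: cvgB => //; exact: cvg_cst. Qed.

Let a_cvg0 : a @ \oo --> (0 : R).
Proof.
rewrite -(sqrtr0 R); apply: continuous_cvg; first exact: sqrt_continuous.
rewrite [X in _ --> X](_ : _ = 2 * 0 / v); last by rewrite mulr0 mul0r.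
by apply: cvgM; [apply: cvgM => //|]; exact: cvg_cst.
Qed.

(* The test function, its image g under the operator I - z avg, the window
   y of altitudes between - K and K where g is not negligible, and the factor e
   by which h is multiplied under I - z avg on either side of the window. *)
Let h n (x : int) : R := expR (- `|x|%:~R * a n).

Let K : nat := (\sum_(s : steps S) absz (val s))%N.

Let sK (s : steps S) : (absz (val s) <= K)%N.
Proof. by rewrite /K (bigD1 s)//= leq_addr. Qed.

Let g n (x : int) : R := h n x - z n * avg S (h n) x.

Let y (i : 'I_K.*2.+1) : int := i%:Z - K%:Z.

Let e (c : R) n : R := 1 - z n * \sum_(s : steps S) step_prob s * expR (c * (val s)%:~R * a n).

Let g_right n x : K%:Z <= x -> g n x = h n x * e (- 1) n.
Proof.
move=> Kx; rewrite /g /e mulrBr mulr1 mulrCA; congr (_ - _ * _).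
rewrite mulr_sumr; apply: eq_bigr => s _; rewrite mulrCA; congr (_ * _).
rewrite /h -expRD; congr expR.
have -> : `|x + val s| = `|x| + val s :> int.
  by move: (sK s) Kx; move: (val s) K => t k; lia.
by rewrite intrD; ring.
Qed.

Let g_left n x : x <= - K%:Z -> g n x = h n x * e 1 n.
Proof.
move=> Kx; rewrite /g /e mulrBr mulr1 mulrCA; congr (_ - _ * _).
rewrite mulr_sumr; apply: eq_bigr => s _; rewrite mulrCA; congr (_ * _).
rewrite /h -expRD; congr expR.
have -> : `|x + val s| = `|x| - val s :> int.
  by move: (sK s) Kx; move: (val s) K => t k; lia.
by rewrite intrD intrN; ring.
Qed.

Let h_le1 n x : 0 <= h n x <= 1.
Proof.
rewrite expR_ge0/= expR_le1 mulNr oppr_le0.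
by apply: mulr_ge0; [rewrite ler0z|exact: ltW].
Qed.

(* This is where the choice of a comes from: the sum in e is
   1 + a ^ 2 v / 2 + o(a ^ 2), and a ^ 2 v / 2 = 1 - z. *)
Let e_cvg (c : R) : c ^+ 2 = 1 -> (fun n => e c n / (1 - z n)) @ \oo --> (0 : R).
Proof.
move=> c2.
pose Q n := \sum_(s : steps S) step_prob s *
  ((expR (c * (val s)%:~R * a n) - 1 - c * (val s)%:~R * a n) / a n ^+ 2).
have Qv : Q @ \oo --> v / 2.
  rewrite (_ : v / 2 = \sum_(s : steps S) step_prob s * ((c * (val s)%:~R) ^+ 2 / 2)).
    apply: cvg_lincomb => s; apply: cvg_expR_taylor2 => // n.
    by rewrite gt_eqF.
  by rewrite /v mulr_suml; apply: eq_bigr => s _; rewrite exprMn c2 mul1r mulrA.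
have eE n : e c n / (1 - z n) = 1 - z n * (2 / v) * Q n.
  have -> : Q n = (\sum_(s : steps S) step_prob s * expR (c * (val s)%:~R * a n) - 1) / a n ^+ 2.
    transitivity ((\sum_(s : steps S) step_prob s * expR (c * (val s)%:~R * a n)
      - \sum_(s : steps S) step_prob s
      - c * a n * \sum_(s : steps S) step_prob s * (val s)%:~R) / a n ^+ 2).
      by rewrite mulr_sumr -!sumrB mulr_suml; apply: eq_bigr => s _; ring.
    by rewrite sum_step_prob mean0 mulr0 subr0.
  rewrite a2 /e; have := step_variance_gt0; have := r_gt0 n.
  move: (\sum_s _) v => q w r0 w0; field.
  by rewrite !gt_eqF.
rewrite (_ : (fun n => _) = (fun n => 1 - z n * (2 / v) * Q n)); last first.
  by apply/funext => n; rewrite eE.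
rewrite [X in _ --> X](_ : _ = 1 - 1 * (2 / v) * (v / 2)); last first.
  by have := step_variance_gt0; move: v => w w0; field; rewrite gt_eqF.
apply: cvgB; first exact: cvg_cst.
by apply: cvgM => //; apply: cvgM => //; exact: cvg_cst.
Qed.

(* The error made when h is replaced by the combination of Green functions with
   the same image in the window. *)
Let d n x : R := h n x - \sum_i g n (y i) * green S (z n) (x - y i).

Let h0 n : h n 0 = 1. Proof. by rewrite /h normr0 oppr0 mul0r expR0. Qed.

Let d_eq n x : d n x - z n * avg S (d n) x =
  g n x - \sum_i g n (y i) * at0 R (x - y i).
Proof.
rewrite /d avgB avg_sum.
have -> : \sum_i g n (y i) * green S (z n) (x - y i) =
    \sum_i g n (y i) * at0 R (x - y i) +
    z n * \sum_i g n (y i) * avg S (fun t => green S (z n) (t - y i)) x.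
  rewrite mulr_sumr -big_split; apply: eq_bigr => i _.
  by rewrite (avg_shift S (green S (z n))) (greenE S (x - y i))//=; ring.
by rewrite /g; ring.
Qed.

Let d_eq_bound n x : `|d n x - z n * avg S (d n) x| <= `|e 1 n| + `|e (- 1) n|.
Proof.
rewrite d_eq; have [xK|xK] := leP `|x| K%:Z.
  have iK : (absz (x + K%:Z)%R < K.*2.+1)%N by lia.
  rewrite (bigD1 (Ordinal iK))//= big1 => [|j ji].
    have -> : y (Ordinal iK) = x by rewrite /y/=; lia.
    by rewrite subrr /at0 eqxx mulr1 addr0 subrr normr0 addr_ge0.
  rewrite /at0; case: eqP => [xj|]; rewrite ?mulr0//.
  by case/eqP: ji; apply: val_inj => /=; move: xj; rewrite /y; lia.
rewrite big1 => [|i _]; last first.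
  rewrite /at0; case: eqP => [xi|]; rewrite ?mulr0//.
  by have := ltn_ord i; move: xi xK; rewrite /y; lia.
rewrite subr0; have [h_ge0 h1] := andP (h_le1 n x).
have [x0|x0] := leP 0 x.
  rewrite g_right; last by lia.
  by rewrite normrM (ger0_norm h_ge0) -[leRHS]addrC ler_wpDr// ler_piMl.
rewrite g_left; last by lia.
by rewrite normrM (ger0_norm h_ge0) ler_wpDr// ler_piMl.
Qed.

Let d_cvg0 : (fun n => d n 0) @ \oo --> (0 : R).
Proof.
have E : (fun n => `|e 1 n / (1 - z n)| + `|e (-1) n / (1 - z n)|) @ \oo --> (0 : R).
  rewrite [X in _ --> X](_ : _ = `|0 : R| + `|0 : R|); last by rewrite normr0 addr0.
  apply: cvgD; first by apply: (cvg_norm (e_cvg _)); rewrite expr1n.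
  by apply: (cvg_norm (e_cvg _)); rewrite sqrrN expr1n.
apply/cvgrPdist_le => eps eps0.
move/cvgrPdist_le : E => /(_ _ eps0); apply: filterS => n.
rewrite !sub0r !normrN ger0_norm; last by rewrite addr_ge0.
move=> He; apply: le_trans He.
rewrite !normrM normfV (gtr0_norm (r_gt0 n)) -mulrDl.
have green_bnd x : `|green S (z n) x| <= (1 - z n)^-1.
  by rewrite ger0_norm ?green_ge0// green_le.
apply: (@discounted_bound _ S _ _ _ (1 + \sum_i `|g n (y i)| * (1 - z n)^-1)) => // x.
rewrite (le_trans (ler_normB _ _))// lerD//.
  by have /andP[? ?] := h_le1 n x; rewrite ger0_norm.
rewrite (le_trans (ler_norm_sum _ _ _))//; apply: ler_sum => i _.
by rewrite normrM ler_wpM2l.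
Qed.

Let g_cvg x : (fun n => g n x / a n) @ \oo -->
  \sum_(s : steps S) step_prob s * `|x + val s|%:~R - `|x|%:~R.
Proof.
have hc (t : int) : (fun n => (h n t - 1) / a n) @ \oo --> (- `|t|%:~R : R).
  by apply: cvg_expR_taylor1 => // n; rewrite gt_eqF.
have gE n : g n x / a n = (h n x - 1) / a n
    - z n * (\sum_(s : steps S) step_prob s * ((h n (x + val s) - 1) / a n))
    + v / 2 * a n.
  have -> : \sum_(s : steps S) step_prob s * ((h n (x + val s) - 1) / a n) =
      (avg S (h n) x - 1) / a n.
    rewrite -[X in _ = (_ - X) / _](sum_step_prob S) -sumrB mulr_suml.
    by apply: eq_bigr => s _; ring.
  have := a2 n; have := a_gt0 n; have := step_variance_gt0; rewrite /g.
  move: v (a n) (avg _ _ _) (h n x) => w b q t w0 b0 b2.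
  have -> : w / 2 * b = (1 - z n) / b.
    apply/eqP; rewrite eq_sym; apply/eqP.
    have -> : 1 - z n = w / 2 * b ^+ 2 by rewrite b2; field; rewrite gt_eqF.
    by field; rewrite gt_eqF.
  by field; rewrite gt_eqF.
rewrite (funext gE).
rewrite [X in _ --> X](_ : _ = (- `|x|%:~R : R)
  - 1 * (\sum_(s : steps S) step_prob s * - `|x + val s|%:~R) + v / 2 * 0); last first.
  rewrite mulr0 addr0 mul1r addrC -sumrN; congr (_ + _).
  by apply: eq_bigr => s _; rewrite mulrN opprK.
apply: cvgD; last by apply: cvgM a_cvg0; exact: cvg_cst.
apply: cvgB => //; apply: cvgM => //; apply: cvg_lincomb => s; exact: hc.
Qed.

(* The mean of |y + s| - |y| over the steps s, summed over the window, is the mean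
   of s ^ 2: this makes the step variance appear. *)
Let sum_g_cvg : \sum_(i < K.*2.+1)
  (\sum_(s : steps S) step_prob s * `|y i + val s|%:~R - `|y i|%:~R) = v.
Proof.
transitivity (\sum_(s : steps S) step_prob s *
    \sum_(i < K.*2.+1) (`|y i + val s|%:~R - `|y i|%:~R) : R).
  under [RHS]eq_bigr do rewrite mulr_sumr.
  rewrite exchange_big; apply: eq_bigr => i _.
  under [RHS]eq_bigr do rewrite mulrBr.
  by rewrite sumrB -mulr_suml sum_step_prob mul1r.
apply: eq_bigr => s _; congr (_ * _).
by rewrite sumrB (sum_abs_shiftR R (sK s)) addrAC subrr add0r.
Qed.

Let G n : R := green S (z n) 0.

Let G_ge1 n : 1 <= G n. Proof. exact: green0_ge1. Qed.

Let T n : R := \sum_i g n (y i) * (green S (z n) (- y i) / G n).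

Let d0E n : d n 0 = 1 - G n * T n.
Proof.
rewrite /d h0 mulr_sumr; congr (_ - _); apply: eq_bigr => i _.
have G0 : G n != 0 by rewrite gt_eqF// (lt_le_trans ltr01).
by rewrite sub0r; field.
Qed.

Let g_cvg0 x : (fun n => g n x) @ \oo --> (0 : R).
Proof.
rewrite (_ : (fun n => _) = fun n => g n x / a n * a n); last first.
  by apply/funext => n; rewrite mulfVK// gt_eqF.
rewrite [X in _ --> X](_ : _ = (\sum_(s : steps S) step_prob s *
   `|x + val s|%:~R - `|x|%:~R) * 0 :> R); last by rewrite mulr0.
by apply: cvgM => //; exact: g_cvg.
Qed.

Let G_cvgy : (fun n => (G n)^-1) @ \oo --> (0 : R).
Proof.
pose bnd n := \sum_i 1 * `|g n (y i)| + `|d n 0|.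
have B0 : bnd @ \oo --> (0 : R).
  rewrite [X in _ --> X](_ : _ = \sum_(i < K.*2.+1) 1 * `|0 : R| + `|0 : R|); last first.
    by rewrite normr0 addr0 big1// => i _; rewrite mulr0.
  by apply: cvgD; [apply: cvg_lincomb => i; exact: cvg_norm|exact: cvg_norm].
apply: (@squeeze_cvgr _ _ _ _ (cst 0) bnd) => //; last exact: cvg_cst.
apply: nearW => n; have G0 : 0 < G n by rewrite (lt_le_trans ltr01).
rewrite /= invr_ge0 (ltW G0)/=.
have E : (G n)^-1 = T n + d n 0 / G n.
  by rewrite d0E; field; rewrite gt_eqF.
rewrite -(ger0_norm (_ : 0 <= (G n)^-1)) ?invr_ge0 ?(ltW G0)// E.
rewrite (le_trans (ler_normD _ _))// lerD//.
  rewrite (le_trans (ler_norm_sum _ _ _))//; apply: ler_sum => i _.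
  rewrite mul1r normrM ler_piMr// ger0_norm ?divr_ge0 ?green_ge0 ?(ltW G0)//.
  by rewrite ler_pdivrMr// mul1r green_max.
rewrite normrM ler_piMr// normfV ger0_norm ?(ltW G0)//.
by rewrite invf_le1.
Qed.

(** At 0 the comparison of h with the Green functions reads
1 - green z 0 * T = o(1) with T / a tending to v, and a is the square root of
2 (1 - z) / v. *)
Lemma cvg_inv_green : (fun n => (green S (z n) 0)^-1 / Num.sqrt (1 - z n)) @ \oo -->
  Num.sqrt (2 * v).
Proof.
have Tv : (fun n => T n / a n) @ \oo --> v.
  rewrite (_ : (fun n => _) = fun n => \sum_(i < K.*2.+1) 1 *
      (g n (y i) / a n * (green S (z n) (- y i) / G n))).
    rewrite [X in _ --> X](_ : _ = \sum_(i < K.*2.+1) 1 *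
      ((\sum_(s : steps S) step_prob s * `|y i + val s|%:~R - `|y i|%:~R) * 1)); last first.
      by rewrite -sum_g_cvg; apply: eq_bigr => i _; rewrite mul1r mulr1.
    apply: cvg_lincomb => i; apply: cvgM; first exact: g_cvg.
    by apply: cvg_green_ratio.
  apply/funext => n; rewrite /T mulr_suml; apply: eq_bigr => i _.
  by rewrite mul1r mulrAC.
have sqv : Num.sqrt (2 * v) = v * Num.sqrt (2 / v).
  apply/eqP; rewrite -(@eqrXn2 _ 2)//; last first.
    by rewrite mulr_ge0// ltW// step_variance_gt0.
  rewrite exprMn !sqr_sqrtr.
  - by apply/eqP; have := step_variance_gt0; move: v => w w0; field; rewrite gt_eqF.
  - by rewrite divr_ge0// ltW// step_variance_gt0.
  - by rewrite mulr_ge0// ltW// step_variance_gt0.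
rewrite sqv.
have lim : (fun n => T n / a n * (1 - d n 0)^-1 * Num.sqrt (2 / v)) @ \oo -->
    v * Num.sqrt (2 / v).
  rewrite [X in _ --> X](_ : _ = v * (1 - 0)^-1 * Num.sqrt (2 / v)); last by rewrite subr0 invr1 mulr1.
  apply: cvgM; last exact: cvg_cst.
  apply: cvgM => //; apply: cvgV; first by rewrite subr0 oner_neq0.
  by apply: cvgB => //; exact: cvg_cst.
apply: cvg_trans lim; apply: near_eq_cvg.
have half : (0 : R) < 1 / 2 by rewrite divr_gt0.
move/cvgrPdist_le : d_cvg0 => /(_ _ half); apply: filterS => n.
rewrite sub0r normrN => dn.
have G0 : G n != 0 by rewrite gt_eqF// (lt_le_trans ltr01).
have d1 : 1 - d n 0 != 0.
  by rewrite subr_eq0 eq_sym; apply/eqP => d1; move: dn; rewrite d1 normr1; lra.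
have TE : T n = (1 - d n 0) / G n by rewrite d0E; field.
have aE : a n = Num.sqrt (1 - z n) * Num.sqrt (2 / v).
  by rewrite /a -sqrtrM ?(ltW (r_gt0 n))//; congr Num.sqrt; rewrite mulrCA mulrA.
rewrite TE aE -/(G n).
have v2 : Num.sqrt (2 / v) != 0 by rewrite gt_eqF// sqrtr_gt0 divr_gt0// step_variance_gt0.
have r2 : Num.sqrt (1 - z n) != 0 by rewrite gt_eqF// sqrtr_gt0.
by field; rewrite G0 d1 v2 r2.
Qed.

End green_asymptotics.

(** * Normal and half-normal distribution functions *)

Section normal_cdf.
Context (R : realType) (sg : R).
Context (sg_gt0 : 0 < sg).

Let sg0 : sg != 0. Proof. by rewrite gt_eqF. Qed.

Local Notation npdf := (normal_pdf 0 sg).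

Definition normal_cdf (t : R) : R := fine (normal_prob 0 sg `]-oo, t]%classic).

Lemma normal_cdfE t : (normal_cdf t)%:E = normal_prob 0 sg `]-oo, t]%classic.
Proof.
rewrite /normal_cdf fineK//.
exact: (fin_num_measure (normal_prob 0 sg : probability _ R)).
Qed.

Lemma normal_cdf_le1 t : normal_cdf t <= 1.
Proof.
rewrite -lee_fin normal_cdfE.
exact: (probability_le1 (normal_prob 0 sg : probability _ R)).
Qed.

Lemma normal_cdf_ge0 t : 0 <= normal_cdf t.
Proof.
rewrite -lee_fin normal_cdfE; exact: (measure_ge0 (normal_prob 0 sg : probability _ R)).
Qed.

Lemma is_derive_normal_cdf (t : R) : is_derive t 1 normal_cdf (npdf t).
Proof.
have int : lebesgue_measure.-integrable `]-oo, (t + 1)%R]%classic (EFin \o npdf).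
  by apply: (integrableS _ _ (subsetT _)) => //; exact: integrable_normal_pdf.
have tt : t < t + 1 by rewrite ltrDl.
have [] := @continuous_FTC1 R npdf -oo%O t (t + 1) tt int (ltNyr _).
  exact: continuous_normal_pdf.
rewrite derive1E => D1 D2; exact: DeriveDef D1 D2.
Qed.

Let idTR : measurableTypeR R -> R := idfun.
#[local] HB.instance Definition _ :=
  @isMeasurableFun.Build _ _ _ _ idTR (@measurable_id _ _ setT).

Lemma cvg_normal_cdfy : normal_cdf t @[t --> +oo] --> (1 : R).
Proof.
have := cvg_cdfy1 (idTR : {RV (normal_prob 0 sg : probability _ R) >-> R}).
rewrite (_ : cdf _ = EFin \o normal_cdf) => [|]; last first.
  by apply/funext => t; rewrite /= normal_cdfE.
by move/fine_cvgP => [].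
Qed.

Lemma cvg_normal_cdfNy : normal_cdf t @[t --> -oo] --> (0 : R).
Proof.
have := cvg_cdfNy0 (idTR : {RV (normal_prob 0 sg : probability _ R) >-> R}).
rewrite (_ : cdf _ = EFin \o normal_cdf) => [|]; last first.
  by apply/funext => t; rewrite /= normal_cdfE.
by move/fine_cvgP => [].
Qed.

Lemma halfnormal_peak :
  Num.sqrt (2 / (pi * sg ^+ 2)) = 2 * normal_peak sg :> R.
Proof.
have p0 : (pi : R) != 0 by rewrite gt_eqF ?pi_gt0.
have sp : 0 <= sg ^+ 2 * pi *+ 2 by rewrite mulrn_wge0// mulr_ge0 ?sqr_ge0 ?pi_ge0.
apply/eqP; rewrite -(@eqrXn2 _ 2)//; last by rewrite mulr_ge0 ?normal_peak_ge0.
rewrite exprMn exprVn !sqr_sqrtr//; last first.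
  by rewrite divr_ge0// mulr_ge0 ?sqr_ge0 ?pi_ge0.
apply/eqP; rewrite -mulr_natr; move: (@pi R) p0 => q q0; field.
by rewrite sg0 q0.
Qed.

(** The half-normal density is twice the normal one on the positive half-line,
so the upper tails are proportional. *)
Lemma halfnormal_cdf t : 0 <= t ->
  halfnormal_prob sg `]-oo, t]%classic = (2 * normal_cdf t - 1)%:E.
Proof.
move=> t0.
have tail_n : normal_prob 0 sg `]t, +oo[%classic = (1 - normal_cdf t)%:E.
  rewrite -setCitvl (probability_setC (normal_prob 0 sg : probability _ R))//.
  by rewrite EFinB normal_cdfE.
have tail_h : halfnormal_prob sg `]t, +oo[%classic = (2 * (1 - normal_cdf t))%:E.
  rewrite EFinM -tail_n /normal_prob -ge0_integralZl//=.
  - apply: eq_integral => x; rewrite inE/= in_itv/= andbT => tx.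
    rewrite /halfnormal_pdf (negbTE sg0) (ltW (le_lt_trans t0 tx)) -EFinM.
    rewrite normal_pdfE// /normal_fun subr0 [in RHS]mulrA; congr (_ * expR _)%:E.
      exact: halfnormal_peak.
    by rewrite -mulNr mulr_natl.
  - apply: measurable_funTS; apply/measurable_EFinP; exact: measurable_normal_pdf.
  - by move=> x _; rewrite lee_fin normal_pdf_ge0.
rewrite -setCitvr (probability_setC (halfnormal_prob sg : probability _ R))//.
by rewrite [X in (1 - X)%E]tail_h -EFinB; congr EFin; ring.
Qed.

End normal_cdf.

(** * The Laplace transform of the limit law *)

Section first_passage_transform.
Context (R : realType) (sg : R).
Context (sg_gt0 : 0 < sg).

Let sg0 : sg != 0. Proof. by rewrite gt_eqF. Qed.

Local Notation npdf := (normal_pdf 0 sg).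
Local Notation Phi := (normal_cdf sg).

(** The known antiderivative of exp(- u ^ 2 / (2 sg ^ 2) - b ^ 2 / (2 sg ^ 2 u ^ 2)),
up to a factor: it comes from (u -+ b / u) ^ 2 = u ^ 2 + b ^ 2 / u ^ 2 -+ 2 b. *)
Definition passage (b u : R) : R :=
  expR (- (b / sg ^+ 2)) * Phi (u - b / u) + expR (b / sg ^+ 2) * Phi (u + b / u).

Lemma is_derive_passage b (u : R) : u != 0 -> is_derive u 1 (passage b)
  (2 * npdf u * expR (- (b ^+ 2 / (2 * sg ^+ 2 * u ^+ 2)))).
Proof.
move=> u0.
have dinv : is_derive u 1 (fun t : R => b / t) (- (b / u ^+ 2)).
  have dV := is_deriveV u0 (is_derive_id u (1:R)).
  by apply: is_derive_eq; rewrite /GRing.scale/=; field.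
have d1 : is_derive u 1 (fun t : R => Phi (t - b / t)) (npdf (u - b / u) * (1 + b / u ^+ 2)).
  apply: (is_derive1_comp (f := Phi)); first exact: is_derive_normal_cdf.
  by apply: is_derive_eq; rewrite opprK.
have d2 : is_derive u 1 (fun t : R => Phi (t + b / t)) (npdf (u + b / u) * (1 - b / u ^+ 2)).
  by apply: (is_derive1_comp (f := Phi)); exact: is_derive_normal_cdf.
apply: is_derive_eq.
rewrite /GRing.scale/= !normal_pdfE// /normal_fun !subr0.
set E := expR (- (b ^+ 2 / _)).
have E1 : expR (- (b / sg ^+ 2)) * expR (- (u - b / u) ^+ 2 / (sg ^+ 2 *+ 2)) =
    expR (- u ^+ 2 / (sg ^+ 2 *+ 2)) * E.
  rewrite -!expRD; congr expR; rewrite -mulr_natr; field; exact/andP.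
have E2 : expR (b / sg ^+ 2) * expR (- (u + b / u) ^+ 2 / (sg ^+ 2 *+ 2)) =
    expR (- u ^+ 2 / (sg ^+ 2 *+ 2)) * E.
  rewrite -!expRD; congr expR; rewrite -mulr_natr; field; exact/andP.
move: E1 E2; move: (expR _) (expR _) (expR _) (expR _) (expR _) E (normal_peak sg) => A B C D F E p.
move=> FD BA.
have -> : F * (p * D * (1 + b / u ^+ 2)) + B * (p * A * (1 - b / u ^+ 2)) =
    p * (F * D) * (1 + b / u ^+ 2) + p * (B * A) * (1 - b / u ^+ 2) by ring.
by rewrite FD BA; ring.
Qed.

Lemma cvgy_linear (c d : R) (w : nat -> R) : 0 < c ->
  (forall n, c * n%:R - d <= w n) -> w @ \oo --> +oo.
Proof.
move=> c0 cw; apply/cvgryPge => A; near=> n.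
apply: le_trans (cw n); rewrite lerBrDr -ler_pdivrMl//.
near: n; exact: nbhs_infty_ger.
Unshelve. all: by end_near. Qed.

Lemma cvg_normal_cdf_comp1 (c d : R) (w : nat -> R) : 0 < c ->
  (forall n, c * n%:R - d <= w n) -> (fun n => Phi (w n)) @ \oo --> (1 : R).
Proof.
by move=> c0 /(cvgy_linear c0) wy; apply: cvg_comp wy _; exact: cvg_normal_cdfy.
Qed.

Lemma cvg_normal_cdf_comp0 (c d : R) (w : nat -> R) : 0 < c ->
  (forall n, c * n%:R - d <= - w n) -> (fun n => Phi (w n)) @ \oo --> (0 : R).
Proof.
move=> c0 /(cvgy_linear c0) wy.
have wNy : w @ \oo --> -oo by apply/cvgNry.
by apply: cvg_comp wNy _; exact: cvg_normal_cdfNy.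
Qed.

Lemma cvg_passage_infty b : 0 < b ->
  (fun n => passage b n.+1%:R) @ \oo -->
  expR (- (b / sg ^+ 2)) + expR (b / sg ^+ 2).
Proof.
move=> b0.
rewrite [X in _ --> X](_ : _ = expR (- (b / sg ^+ 2)) * 1 + expR (b / sg ^+ 2) * 1);
  last by rewrite !mulr1.
apply: cvgD; apply: cvgM; (try exact: cvg_cst).
  apply: (@cvg_normal_cdf_comp1 1 b) => // n.
  rewrite mul1r lerB//; first by rewrite ler_nat.
  by rewrite ler_pdivrMr// ler_peMr ?(ltW b0)// ler1n.
apply: (@cvg_normal_cdf_comp1 1 0) => // n.
by rewrite mul1r subr0 ler_wpDr ?ler_nat// divr_ge0// ltW.
Qed.

Lemma cvg_passage_0 b : 0 < b ->
  (fun n => passage b n.+1%:R^-1) @ \oo --> expR (b / sg ^+ 2).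
Proof.
move=> b0.
rewrite [X in _ --> X](_ : _ = expR (- (b / sg ^+ 2)) * 0 + expR (b / sg ^+ 2) * 1);
  last by rewrite mulr0 add0r mulr1.
have inv1 n : (n.+1%:R^-1 : R) <= 1 by rewrite invf_le1 ?ler1n.
have le_S n : b * n%:R <= b * n.+1%:R by rewrite ler_wpM2l ?(ltW b0)// ler_nat.
apply: cvgD; apply: cvgM; (try exact: cvg_cst).
  apply: (@cvg_normal_cdf_comp0 b 1) => // n.
  by rewrite invrK opprB lerB.
apply: (@cvg_normal_cdf_comp1 b 0) => // n.
by rewrite invrK subr0 ler_wpDl ?invr_ge0.
Qed.

Context (x : R) (q : {poly R}).
Context (x_gt0 : 0 < x).

Let Y u : R := expR (- (x ^+ 2 / u ^+ 2)).

(* The value for which b ^ 2 / (2 sg ^ 2 u ^ 2) = (i + 1) x ^ 2 / u ^ 2. *)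
Let b (i : nat) : R := Num.sqrt (2 * i.+1%:R) * x * sg.

Let b_gt0 i : 0 < b i.
Proof. by rewrite !mulr_gt0// sqrtr_gt0 mulr_gt0. Qed.

Let H u : R := \sum_(i < size q) q`_i * passage (b i) u.

Let Y01 u : 0 <= Y u <= 1.
Proof.
rewrite expR_ge0/= expR_le1 oppr_le0 mulr_ge0 ?sqr_ge0// invr_ge0 sqr_ge0//.
Qed.

Let is_derive_H (u : R) : u != 0 -> is_derive u 1 H (2 * npdf u * (Y u * q.[Y u])).
Proof.
move=> u0.
have -> : 2 * npdf u * (Y u * q.[Y u]) = \sum_(i < size q) q`_i *
    (2 * npdf u * expR (- (b i ^+ 2 / (2 * sg ^+ 2 * u ^+ 2)))).
  rewrite horner_coef !mulr_sumr; apply: eq_bigr => i _.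
  have -> : expR (- (b i ^+ 2 / (2 * sg ^+ 2 * u ^+ 2))) = Y u ^+ i.+1.
    rewrite -expRM_natl; congr expR; rewrite /b !exprMn sqr_sqrtr ?mulr_ge0//.
    by field; exact/andP.
  by rewrite exprS; ring.
by apply: is_derive_lincomb => i; exact: is_derive_passage.
Qed.

(** The expectation of Y q(Y), where Y = exp(- x ^ 2 / U ^ 2) and U is half-normal
of parameter sg; it is the total increment of H over the positive half-line. *)
Definition passage_transform : R :=
  \sum_(i < size q) q`_i * expR (- (Num.sqrt (2 * i.+1%:R) * x / sg)).

Let H_cvg : (fun n => H n.+1%:R - H n.+1%:R^-1) @ \oo --> passage_transform.
Proof.
have -> : passage_transform =
   \sum_(i < size q) q`_i * (expR (- (b i / sg ^+ 2)) + expR (b i / sg ^+ 2)) -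
   \sum_(i < size q) q`_i * expR (b i / sg ^+ 2).
  rewrite -sumrB; apply: eq_bigr => i _; rewrite -mulrBr addrK.
  by congr (_ * expR (- _)); rewrite /b; field.
by apply: cvgB; apply: cvg_lincomb => i; [exact: cvg_passage_infty|exact: cvg_passage_0].
Qed.

Let H_mono (k s t : R) : 0 < s -> s <= t ->
  (forall u, s <= u <= t -> Y u * q.[Y u] <= k) ->
  H t - H s <= k * (2 * (Phi t - Phi s)).
Proof.
move=> s0 st qk.
have H1 := @le_of_derive_ge0 _ (fun u => k * 2 * Phi u - H u)
  (fun u => k * 2 * npdf u - 2 * npdf u * (Y u * q.[Y u])) s t st.
suff : k * 2 * Phi s - H s <= k * 2 * Phi t - H t by lra.
apply: H1 => u sut.
  have u0 : 0 < u by case/andP: sut => su _; exact: lt_le_trans su.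
  have := is_derive_H (lt0r_neq0 u0); have := is_derive_normal_cdf sg_gt0 u => dP dH.
  by apply: is_derive_eq.
rewrite -mulrA mulrC -mulrBr mulr_ge0 ?subr_ge0 ?qk//.
by rewrite mulr_ge0// normal_pdf_ge0.
Qed.

Let H_mono_ge (k s t : R) : 0 < s -> s <= t ->
  (forall u, s <= u <= t -> k <= Y u * q.[Y u]) ->
  k * (2 * (Phi t - Phi s)) <= H t - H s.
Proof.
move=> s0 st qk.
have H1 := @le_of_derive_ge0 _ (fun u => H u - k * 2 * Phi u)
  (fun u => 2 * npdf u * (Y u * q.[Y u]) - k * 2 * npdf u) s t st.
suff : H s - k * 2 * Phi s <= H t - k * 2 * Phi t by lra.
apply: H1 => u sut.
  have u0 : 0 < u by case/andP: sut => su _; exact: lt_le_trans su.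
  have := is_derive_H (lt0r_neq0 u0); have := is_derive_normal_cdf sg_gt0 u => dP dH.
  by apply: is_derive_eq.
rewrite -(mulrA k) [k * _]mulrC -mulrBr mulr_ge0 ?subr_ge0 ?qk//.
by rewrite mulr_ge0// normal_pdf_ge0.
Qed.

Let Y_mono s t : 0 < s -> s <= t -> Y s <= Y t.
Proof.
move=> s0 st; rewrite ler_expR lerN2 ler_wpM2l ?sqr_ge0//.
have t0 := lt_le_trans s0 st.
by rewrite lef_pV2 ?posrE ?exprn_gt0// lerXn2r ?nnegrE ?(ltW s0) ?(ltW t0).
Qed.

Let large (t : R) : \forall n \near \oo, t <= n.+1%:R :> R.
Proof.
near=> n; apply: (@le_trans _ _ n%:R); last by rewrite ler_nat.
near: n; exact: nbhs_infty_ger.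
Unshelve. all: by end_near. Qed.

Let small (t : R) : 0 < t -> \forall n \near \oo, n.+1%:R^-1 <= t :> R.
Proof.
move=> t0; have := large t^-1; apply: filterS => n tn.
by rewrite -[t]invrK lef_pV2 ?posrE ?invr_gt0.
Qed.

(** Y q(Y) is at most eps below t and at most 1 beyond t; integrating these bounds
is comparing the increments of H with those of the distribution function. *)
Lemma passage_transform_le (eps t : R) : 0 < t -> 0 <= eps ->
  (forall y, 0 <= y <= 1 -> y * q.[y] <= 1) ->
  (forall y, 0 <= y <= Y t -> y * q.[y] <= eps) ->
  passage_transform <= 2 * (1 - Phi t) + 2 * eps.
Proof.
move=> t0 e0 q1 qe; rewrite -(cvg_lim (@Rhausdorff R) H_cvg).
apply: limr_le; first exact: (cvgP _ H_cvg).
near=> n.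
have tn : t <= n.+1%:R by near: n; exact: large.
have nt : n.+1%:R^-1 <= t by near: n; exact: small.
have h1 : H n.+1%:R - H t <= 1 * (2 * (Phi n.+1%:R - Phi t)).
  by apply: H_mono => // u _; exact/q1/Y01.
have h2 : H t - H n.+1%:R^-1 <= eps * (2 * (Phi t - Phi n.+1%:R^-1)).
  apply: H_mono => //.
  move=> u /andP[nu ut]; apply: qe; have /andP[-> _]/= := Y01 u.
  by apply: Y_mono => //; apply: lt_le_trans nu; rewrite invr_gt0.
have p1 := normal_cdf_le1 sg n.+1%:R.
have : Phi t - Phi n.+1%:R^-1 <= 1.
  by have := normal_cdf_le1 sg t; have := normal_cdf_ge0 sg n.+1%:R^-1; lra.
move=> /(ler_wpM2l e0); lra.
Unshelve. all: by end_near. Qed.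

Lemma passage_transform_ge (eps t : R) : 0 < t ->
  (forall y, 0 <= y <= 1 -> 0 <= y * q.[y]) ->
  (forall y, Y t <= y <= 1 -> 1 - eps <= y * q.[y]) ->
  (1 - eps) * (2 * (1 - Phi t)) <= passage_transform.
Proof.
move=> t0 q0 qe.
have lim : (fun n => (1 - eps) * (2 * (Phi n.+1%:R - Phi t))) @ \oo -->
    (1 - eps) * (2 * (1 - Phi t)).
  apply: cvgM; first exact: cvg_cst.
  apply: cvgM; first exact: cvg_cst.
  apply: cvgB; last exact: cvg_cst.
  by apply: (@cvg_normal_cdf_comp1 1 0) => // n; rewrite mul1r subr0 ler_nat.
rewrite -(cvg_lim (@Rhausdorff R) H_cvg) -(cvg_lim (@Rhausdorff R) lim).
apply: ler_lim; [exact: (cvgP _ lim)|exact: (cvgP _ H_cvg)|].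
near=> n.
have tn : t <= n.+1%:R by near: n; exact: large.
have nt : n.+1%:R^-1 <= t by near: n; exact: small.
have h1 : (1 - eps) * (2 * (Phi n.+1%:R - Phi t)) <= H n.+1%:R - H t.
  apply: H_mono_ge => // u /andP[tu un]; apply: qe.
  by have /andP[_ ->] := Y01 u; rewrite andbT; exact: Y_mono.
have h2 : 0 * (2 * (Phi t - Phi n.+1%:R^-1)) <= H t - H n.+1%:R^-1.
  apply: H_mono_ge => //.
  by move=> u _; exact/q0/Y01.
lra.
Unshelve. all: by end_near. Qed.

End first_passage_transform.

(** * Approximation of step functions by polynomials *)

Section approximate_steps.
Context (R : realType).
Implicit Types (c eps x y : R).

Lemma bernoulli_ineq x n : - 1 <= x -> 1 + n%:R * x <= (1 + x) ^+ n.
Proof.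
move=> x1; elim: n => [|n IH]; first by rewrite mul0r addr0 expr0.
have x10 : 0 <= 1 + x by lra.
rewrite exprS; apply: le_trans (ler_wpM2l x10 IH).
have := mulr_ge0 (ler0n R n) (sqr_ge0 x); rewrite -natr1 expr2; lra.
Qed.

(** (1 - x) ^ n * (1 + x) ^ n <= 1, and (1 + x) ^ n >= n x. *)
Lemma expr_1B_le x n : 0 <= x <= 1 -> (1 - x) ^+ n * (n%:R * x) <= 1.
Proof.
move=> /andP[x0 x1]; have x10 : 0 <= 1 - x by lra.
apply: (@le_trans _ _ ((1 - x) ^+ n * (1 + x) ^+ n)).
  apply: ler_wpM2l; first exact: exprn_ge0.
  apply: le_trans (bernoulli_ineq n (_ : -1 <= x)); last by lra.
  by rewrite lerDr.
rewrite -exprMn exprn_ile1//; first by rewrite mulr_ge0//; lra.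
by have := sqr_ge0 x; rewrite expr2; lra.
Qed.

(** A suitable b exists once the interval from 1 / (eps c ^ a) to eps / c' ^ a
has length at least 1, which holds for large a as c' / c < 1. *)
Lemma exists_exponents (c' c eps : R) : 0 < c' -> c' < c -> c <= 1 -> 0 < eps ->
  exists a b : nat, b.+1%:R * c' ^+ a.+1 <= eps /\ 1 <= eps * (b.+1%:R * c ^+ a.+1).
Proof.
move=> c'0 cc' c1 e0; have c0 := lt_trans c'0 cc'.
have lim : (fun n => (c' / c) ^+ n / eps + c' ^+ n) @ \oo --> (0 : R).
  rewrite [X in _ --> X](_ : _ = 0 / eps + 0); last by rewrite mul0r addr0.
  apply: cvgD; last by apply: cvg_expr; rewrite gtr0_norm// (lt_le_trans cc').
  apply: cvgM; last exact: cvg_cst.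
  apply: cvg_expr; rewrite gtr0_norm ?divr_gt0//.
  by rewrite ltr_pdivrMr// mul1r.
move: lim; rewrite -cvg_shiftS => /cvgrPdist_le/(_ _ e0)[a _ /(_ a (leqnn a))] /=.
rewrite sub0r normrN ger0_norm; last first.
  by rewrite addr_ge0 ?divr_ge0 ?exprn_ge0 ?divr_ge0// ltW.
move=> Ha; exists a, (Num.truncn (eps * c ^+ a.+1)^-1).
set t := (eps * c ^+ a.+1)^-1.
have ca := exprn_gt0 a.+1 c0; have c'a := exprn_gt0 a.+1 c'0.
have t0 : 0 <= t by rewrite invr_ge0 mulr_ge0// ltW.
have /andP[t1 t2] := truncn_itv t0; split.
  apply: le_trans Ha; rewrite -natr1 mulrDl mul1r lerD2r.
  apply: le_trans (_ : t * c' ^+ a.+1 <= _).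
    by apply: ler_wpM2r => //; exact: ltW.
  rewrite /t expr_div_n invfM le_eqVlt; apply/orP; left; apply/eqP; ring.
rewrite mulrCA -ler_pdivrMr ?mulr_gt0// div1r; exact: ltW.
Qed.

(** The polynomial is 1 - (1 - y ^ a) ^ b, where b is large compared to 1 / c ^ a
and small compared to 1 / c' ^ a. The factor y matters: it makes the polynomial
vanish at y = 0, the value that stands for an infinite return time. *)
Lemma exists_step_polynomial (c' c eps : R) : 0 < c' -> c' < c -> c <= 1 -> 0 < eps ->
  exists q : {poly R}, [/\ forall y, 0 <= y <= 1 -> 0 <= y * q.[y] <= 1,
    forall y, 0 <= y <= c' -> y * q.[y] <= eps &
    forall y, c <= y <= 1 -> 1 - eps <= y * q.[y] ].
Proof.
move=> c'0 cc' c1 e0; have c0 := lt_trans c'0 cc'.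
have [a [b [ab1 ab2]]] := exists_exponents c'0 cc' c1 e0.
pose p : {poly R} := 1 - (1 - 'X^(a.+1)) ^+ b.+1.
have pE y : p.[y] = 1 - (1 - y ^+ a.+1) ^+ b.+1.
  by rewrite /p !hornerE.
have : root p 0 by rewrite /root pE expr0n subr0 expr1n subrr.
move=> /factor_theorem[q pq]; exists q.
have qE y : y * q.[y] = 1 - (1 - y ^+ a.+1) ^+ b.+1.
  by rewrite -pE pq hornerM hornerXsubC subr0 mulrC.
have ya y : 0 <= y <= 1 -> 0 <= y ^+ a.+1 <= 1.
  by move=> /andP[y0 y1]; rewrite exprn_ge0//= exprn_ile1.
split=> y; rewrite qE.
- move=> /ya/andP[y0 y1]; have z0 : 0 <= 1 - y ^+ a.+1 by lra.
  have z1 : 1 - y ^+ a.+1 <= 1 by lra.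
  have := exprn_ge0 b.+1 z0; have := exprn_ile1 b.+1 z0 z1; lra.
- move=> /andP[y0 yc'].
  have y1 : y <= 1 by rewrite (le_trans yc')// (le_trans (ltW cc')).
  have /andP[ya0 ya1] := ya y (introT andP (conj y0 y1)).
  have := @bernoulli_ineq (- y ^+ a.+1) b.+1; rewrite lerN2 => /(_ ya1) H.
  have : b.+1%:R * y ^+ a.+1 <= eps.
    by apply: le_trans ab1; rewrite ler_wpM2l// lerXn2r// nnegrE ltW.
  by lra.
- move=> /andP[cy y1]; have y0 := lt_le_trans c0 cy.
  have ya01 := ya y (introT andP (conj (ltW y0) y1)).
  have := @expr_1B_le _ b.+1 ya01.
  have : 1 <= eps * (b.+1%:R * y ^+ a.+1).
    apply: le_trans ab2 _; rewrite ler_wpM2l ?(ltW e0)// ler_wpM2l// lerXn2r// nnegrE ltW//.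
  have : 0 <= (1 - y ^+ a.+1) ^+ b.+1 by rewrite exprn_ge0// subr_ge0; case/andP: ya01.
  move: ((1 - _) ^+ _) (_ * y ^+ _) => u w u0 w1 uw.
  suff : u <= eps by lra.
  have := ler_wpM2l u0 w1; rewrite mulr1 mulrCA => /le_trans; apply.
  by apply: ler_piMr => //; exact: ltW.
Qed.

End approximate_steps.

(** Below, a n is thought of as the probability that a random time T with values in
the natural numbers or infinite is at most n. Then abel z is the expectation of
z ^ T, and the transform is the expectation of Y q(Y) with Y = w ^ T. *)
Section discrete_transform.
Context (R : realType) (a : nat -> R).
Context (a01 : forall n, 0 <= a n <= 1).
Context (a_nd : nondecreasing_seq a).

Let incr m : R := a m - (if m is m'.+1 then a m' else 0).

Let incr_ge0 m : 0 <= incr m.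
Proof.
rewrite /incr; case: m => [|m]; first by rewrite subr0; case/andP: (a01 0).
by rewrite subr_ge0; exact: a_nd.
Qed.

Let sum_incr n : \sum_(m < n.+1) incr m = a n.
Proof.
elim: n => [|n IH]; first by rewrite big_ord1 /incr subr0.
by rewrite big_ord_recr/= IH /incr addrC subrK.
Qed.

Definition abel z : R := (1 - z) * discounted z a.

(* Summation by parts. *)
Let cvg_abel (z : R) : 0 <= z < 1 ->
  (fun N => \sum_(m < N) incr m * z ^+ m) @ \oo --> abel z.
Proof.
move=> z01; have /andP[z0 z1] := z01.
suff H : (fun N => \sum_(m < N.+1) incr m * z ^+ m) @ \oo --> abel z.
  by rewrite -cvg_shiftS.
rewrite (_ : (fun N => _) = fun N => (1 - z) * series (fun n => z ^+ n * a n) N + z ^+ N * a N).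
  rewrite [X in _ --> X](_ : _ = abel z + 0); last by rewrite addr0.
  apply: cvgD; first by apply: cvgM; [exact: cvg_cst|exact: is_cvg_discounted].
  apply: (@squeeze_cvgr _ _ _ _ (cst 0) (fun n => z ^+ n)).
  - apply: nearW => n; have /andP[a0 a1] := a01 n.
    by rewrite /= mulr_ge0 ?exprn_ge0//= ler_piMr// exprn_ge0.
  - exact: cvg_cst.
  - by apply: cvg_expr; rewrite ger0_norm.
apply/funext; elim => [|N IH].
  by rewrite big_ord1 /incr subr0 /series/= big_geq// mulr0 add0r mulrC.
rewrite big_ord_recr/= IH seriesSr /incr exprS; ring.
Qed.

Definition discrete_transform (w : R) (q : {poly R}) : R :=
  \sum_(i < size q) q`_i * abel (w ^+ i.+1).

Let cvg_discrete_transform (w : R) q : 0 <= w < 1 ->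
  (fun N => \sum_(m < N) incr m * (w ^+ m * q.[w ^+ m])) @ \oo --> discrete_transform w q.
Proof.
move=> /andP[w0 w1].
rewrite (_ : (fun N => _) = fun N => \sum_(i < size q) q`_i *
    \sum_(m < N) incr m * (w ^+ i.+1) ^+ m).
  apply: cvg_lincomb => i; apply: cvg_abel.
  by rewrite exprn_ge0//= exprn_ilt1// ltW.
apply/funext => N; under [RHS]eq_bigr do rewrite mulr_sumr.
rewrite exchange_big; apply: eq_bigr => m _.
rewrite horner_coef !mulr_sumr; apply: eq_bigr => i _.
by rewrite -!exprM [(i.+1 * m)%N]mulnC mulnS exprD exprM; ring.
Qed.

Let wn01 (w : R) m : 0 <= w < 1 -> 0 <= w ^+ m <= 1.
Proof. by move=> /andP[w0 w1]; rewrite exprn_ge0//= exprn_ile1// ltW. Qed.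

Let wn_nincr (w : R) m n : 0 <= w < 1 -> (m <= n)%N -> w ^+ n <= w ^+ m.
Proof. by move=> /andP[w0 w1] mn; apply: ler_wiXn2l => //; exact: ltW. Qed.

Lemma discrete_transform_ge (w : R) q (eps : R) n : 0 <= w < 1 ->
  (forall y, 0 <= y <= 1 -> 0 <= y * q.[y]) ->
  (forall y, w ^+ n <= y <= 1 -> 1 - eps <= y * q.[y]) ->
  (1 - eps) * a n <= discrete_transform w q.
Proof.
move=> w01 q0 qe; rewrite -(cvg_lim (@Rhausdorff R) (@cvg_discrete_transform w q w01)).
apply: limr_ge; first exact: (cvgP _ (@cvg_discrete_transform w q w01)).
exists n.+1 => // N /= nN.
rewrite -(subnKC nN) big_split_ord/= ler_wpDr//.
  by apply: sumr_ge0 => m _; rewrite mulr_ge0// q0// wn01.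
rewrite -sum_incr mulr_sumr; apply: ler_sum => m _; rewrite mulrC ler_wpM2l//.
apply: qe; have /andP[_ ->] := wn01 m w01; rewrite andbT wn_nincr//.
by rewrite -ltnS.
Qed.

Lemma discrete_transform_le (w : R) q (eps : R) n : 0 <= w < 1 -> 0 <= eps ->
  (forall y, 0 <= y <= 1 -> y * q.[y] <= 1) ->
  (forall y, 0 <= y <= w ^+ n -> y * q.[y] <= eps) ->
  discrete_transform w q <= a n + eps.
Proof.
move=> w01 e0 q1 qe; rewrite -(cvg_lim (@Rhausdorff R) (@cvg_discrete_transform w q w01)).
apply: limr_le; first exact: (cvgP _ (@cvg_discrete_transform w q w01)).
exists n.+1 => // N /= nN.
have aN : \sum_(m < N) incr m <= 1.
  by case: N nN => // N _; rewrite sum_incr; case/andP: (a01 N).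
rewrite -(subnKC nN) big_split_ord/=; apply: lerD.
  rewrite -sum_incr; apply: ler_sum => m _; rewrite ler_piMr// q1// wn01//.
apply: (@le_trans _ _ (eps * \sum_(m < N - n.+1) incr (n.+1 + m))).
  rewrite mulr_sumr; apply: ler_sum => m _; rewrite mulrC ler_wpM2r//.
  apply: qe; have /andP[-> _] := wn01 (n.+1 + m) w01.
  by rewrite wn_nincr//; lia.
apply: ler_piMr => //; apply: le_trans aN; rewrite -[in leRHS](subnKC nN) big_split_ord/=.
by rewrite ler_wpDl// sumr_ge0.
Qed.

End discrete_transform.

(** * Convergence of the tails under zero drift *)

Section recurrent.
Context (R : realType) (S : step_set R).

(** exp(- e / (1 - e)) <= 1 - e <= exp(- e), both from 1 + t <= exp t. *)
Lemma cvg_1B_expn (e : nat -> R) (k : nat -> nat) (c : R) :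
  (forall n, 0 <= e n) -> e @ \oo --> (0 : R) ->
  (fun n => (k n)%:R * e n) @ \oo --> c ->
  (fun n => (1 - e n) ^+ k n) @ \oo --> expR (- c).
Proof.
move=> e0 ecvg kec.
apply: (@squeeze_cvgr _ _ _ _ (fun n => expR (- ((k n)%:R * e n * (1 - e n)^-1)))
  (fun n => expR (- ((k n)%:R * e n)))).
- have half : (0 : R) < 1 / 2 by rewrite divr_gt0.
  move/cvgrPdist_le : ecvg => /(_ _ half); apply: filterS => n.
  rewrite sub0r normrN ger0_norm// => en.
  have e1 : 0 < 1 - e n by lra.
  have -> : expR (- ((k n)%:R * e n / (1 - e n))) = expR (- (e n / (1 - e n))) ^+ k n.
    by rewrite -expRM_natl; congr expR; ring.
  have -> : expR (- ((k n)%:R * e n)) = expR (- e n) ^+ k n.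
    by rewrite -expRM_natl; congr expR; ring.
  apply/andP; split; apply: lerXn2r; rewrite ?nnegrE ?expR_ge0 ?(ltW e1)//.
    rewrite expRN -[leRHS]invrK lef_pV2 ?posrE ?expR_gt0 ?invr_gt0//.
    apply: le_trans (expR_ge1Dx _); rewrite le_eqVlt; apply/orP; left; apply/eqP.
    by field; rewrite gt_eqF.
  exact: expR_ge1Dx.
- apply: continuous_cvg; first exact: continuous_expR.
  apply: cvgN; rewrite [X in _ --> X](_ : _ = c * (1 - 0)^-1); last first.
    by rewrite subr0 invr1 mulr1.
  apply: cvgM => //; apply: cvgV; first by rewrite subr0 oner_neq0.
  by apply: cvgB => //; exact: cvg_cst.
- by apply: continuous_cvg; [exact: continuous_expR|exact: cvgN].
Qed.

Let inv_cvg0 : (fun n => n.+1%:R^-1 : R) @ \oo --> (0 : R).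
Proof. exact: cvg_harmonic. Qed.

Let inv_neq0 n : (n.+1%:R^-1 : R) != 0.
Proof. by rewrite invr_eq0 pnatr_eq0. Qed.

Context (aper : aperiodic S).
Context (mean0 : \sum_(s : steps S) step_prob s * (val s)%:~R = 0).

Let v : R := \sum_(s : steps S) step_prob s * (val s)%:~R ^+ 2.

Context (x : R).
Context (x_gt0 : 0 < x).

(* At least k n returns in n steps means that the number of returns exceeds
   x sqrt n. *)
Let k n : nat := (Num.truncn (x * Num.sqrt n%:R)).+1.

Let sqrt_gt0 n : 0 < Num.sqrt (n.+1%:R : R).
Proof. by rewrite sqrtr_gt0. Qed.

Let k_cvg : (fun n => (k n.+1)%:R / Num.sqrt n.+1%:R) @ \oo --> x.
Proof.
have isq : (fun n => (Num.sqrt n.+1%:R : R)^-1) @ \oo --> (0 : R).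
  rewrite (_ : (fun n => _) = fun n => Num.sqrt (n.+1%:R^-1 : R)).
    rewrite -[X in _ --> X](sqrtr0 R); apply: continuous_cvg => //.
    exact: sqrt_continuous.
  by apply/funext => n; rewrite sqrtrV.
apply: (@squeeze_cvgr _ _ _ _ (cst x) (fun n => x + (Num.sqrt n.+1%:R)^-1)).
- apply: nearW => n /=; rewrite /k.
  have /andP[t1 t2] := truncn_itv (mulr_ge0 (ltW x_gt0) (sqrtr_ge0 n.+1%:R)).
  rewrite ler_pdivlMr// (ltW t2)/= ler_pdivrMr// mulrDl mulVf ?gt_eqF//.
  by rewrite -natr1 lerD2r.
- exact: cvg_cst.
- by rewrite -[X in _ --> X]addr0; apply: cvgD => //; exact: cvg_cst.
Qed.

(* With n + 1 steps, w = exp(- 1 / (n + 1)); thus w ^ T >= exp(- 1) if and only if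
   T <= n + 1. *)
Let w n : R := expR (- n.+1%:R^-1).

Let w01 n : 0 <= w n < 1.
Proof. by rewrite expR_ge0/= expR_lt1 oppr_lt0 invr_gt0. Qed.

Let wX n j : w n ^+ j = expR (- j%:R * n.+1%:R^-1).
Proof. by rewrite -expRM_natl mulrN mulNr. Qed.

Let wj01 n j : 0 <= w n ^+ j.+1 < 1.
Proof. by have /andP[w0 w1] := w01 n; rewrite exprn_ge0//= exprn_ilt1. Qed.

Let wn n : w n ^+ n.+1 = expR (- 1).
Proof. by rewrite wX mulNr divff// pnatr_eq0. Qed.

Let w_cvg j : (fun n => (1 - w n ^+ j) * n.+1%:R) @ \oo --> (j%:R : R).
Proof.
rewrite (_ : (fun n => _) =
    fun n => - ((expR (- j%:R * n.+1%:R^-1) - 1) / n.+1%:R^-1)); last first.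
  by apply/funext => n; rewrite wX invrK -mulNr opprB.
rewrite -[X in _ --> X]opprK; apply: cvgN.
exact: (@cvg_expR_taylor1 _ _ inv_cvg0 inv_neq0 (- j%:R)).
Qed.

Let w_cvg1 j : (fun n => w n ^+ j) @ \oo --> (1 : R).
Proof.
rewrite (_ : (fun n => _) = fun n => expR (- j%:R * n.+1%:R^-1)); last first.
  by apply/funext => n; rewrite wX.
rewrite -[X in _ --> X]expR0; apply: continuous_cvg; first exact: continuous_expR.
rewrite [X in _ --> X](_ : _ = - j%:R * 0); last by rewrite mulr0.
by apply: cvgM => //; exact: cvg_cst.
Qed.

Let hitting_cvg j : (fun n => (1 - (green S (w n ^+ j.+1) 0)^-1) ^+ k n.+1) @ \oo -->
  expR (- (Num.sqrt (2 * j.+1%:R) * x * Num.sqrt v)).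
Proof.
pose z n := w n ^+ j.+1; have z01 n : 0 <= z n < 1 by exact: wj01.
have r0 n : 0 < 1 - z n by have /andP[_] := z01 n; rewrite subr_gt0.
have all n : reachable S n by exact: aperiodic_reachable.
have IG := cvg_inv_green z01 (w_cvg1 j.+1) mean0 all.
have G0 n : 0 <= (green S (z n) 0)^-1 by rewrite invr_ge0 green_ge0.
have rs : (fun n => Num.sqrt (1 - z n)) @ \oo --> (0 : R).
  rewrite -[X in _ --> X](sqrtr0 R); apply: continuous_cvg => //; first exact: sqrt_continuous.
  rewrite -(subrr (1 : R)); apply: cvgB; first exact: cvg_cst.
  exact: w_cvg1.
have IG0 : (fun n => (green S (z n) 0)^-1) @ \oo --> (0 : R).
  rewrite (_ : (fun n => _) = fun n => (green S (z n) 0)^-1 / Num.sqrt (1 - z n) * Num.sqrt (1 - z n)).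
    by rewrite [X in _ --> X](_ : _ = Num.sqrt (2 * v) * 0); [exact: cvgM|rewrite mulr0].
  by apply/funext => n; rewrite mulfVK// gt_eqF// sqrtr_gt0.
apply: cvg_1B_expn => //.
rewrite (_ : (fun n => _) = fun n => (k n.+1)%:R / Num.sqrt n.+1%:R *
   ((green S (z n) 0)^-1 / Num.sqrt (1 - z n)) * Num.sqrt ((1 - z n) * n.+1%:R)).
  rewrite [X in _ --> X](_ : _ = x * Num.sqrt (2 * v) * Num.sqrt j.+1%:R); last first.
    by rewrite !sqrtrM//; ring.
  apply: cvgM; first exact: cvgM.
  by apply: continuous_cvg; [exact: sqrt_continuous|exact: w_cvg].
apply/funext => n; rewrite sqrtrM ?(ltW (r0 n))// -/(z n).
have := sqrt_gt0 n; have : 0 < Num.sqrt (1 - z n) by rewrite sqrtr_gt0.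
move: (Num.sqrt _) (Num.sqrt _) => s t s0 t0.
have g0 : green S (z n) 0 != 0 by rewrite gt_eqF// (lt_le_trans ltr01)// green0_ge1.
by field; rewrite g0 !gt_eqF.
Qed.

Let sg : R := Num.sqrt v^-1.

Let v_gt0 : 0 < v. Proof. exact: step_variance_gt0. Qed.

Let sg_gt0 : 0 < sg. Proof. by rewrite sqrtr_gt0 invr_gt0. Qed.

Let transform_cvg (q : {poly R}) :
  (fun n => discrete_transform (fun m => tail S (k n.+1) m 0) (w n) q) @ \oo -->
  passage_transform sg x q.
Proof.
rewrite /passage_transform /discrete_transform.
apply: cvg_lincomb => i.
rewrite (_ : (fun n => _) = fun n => (1 - (green S (w n ^+ i.+1) 0)^-1) ^+ k n.+1).
  rewrite (_ : _ / sg = Num.sqrt (2 * i.+1%:R) * x * Num.sqrt v); first exact: hitting_cvg.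
  by rewrite /sg sqrtrV ?invrK// ltW.
by apply/funext => n; rewrite /abel discounted_tail.
Qed.

Local Notation Phi := (normal_cdf sg).

Let Phi_near (eta : R) : 0 < eta -> exists t t' : R,
  [/\ 0 < t, t < x, x < t', Phi x - Phi t <= eta & Phi t' - Phi x <= eta].
Proof.
move=> eta0.
have cPhi : {for x, continuous Phi}.
  apply/differentiable_continuous/derivable1_diffP.
  by have [] := is_derive_normal_cdf sg_gt0 x.
have /cvgrPdist_le/(_ _ eta0)/nbhs_ballP[d /= d0 Hd] := cPhi.
pose m := Num.min d x / 2.
have mm : 0 < Num.min d x by rewrite lt_min d0.
have m0 : 0 < m by rewrite divr_gt0.
have m2 : m < Num.min d x by rewrite ltr_pdivrMr// ltr_pMr// ltr1n.
have md : m < d by rewrite (lt_le_trans m2)// ge_min lexx.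
have mx : m < x by rewrite (lt_le_trans m2)// ge_min lexx orbT.
exists (x - m), (x + m); split; rewrite ?subr_gt0 ?gtrBl ?ltrDl//.
  have /= := Hd (x - m); rewrite /ball/= opprB addrC subrK gtr0_norm// => /(_ md).
  by apply: le_trans; exact: ler_norm.
have /= := Hd (x + m); rewrite /ball/= opprD addrA subrr sub0r normrN gtr0_norm// => /(_ md).
by rewrite distrC; apply: le_trans; exact: ler_norm.
Qed.

(** The step polynomials q and p, with steps just below and just above exp(- 1),
bound the tail from above and from below; their transforms converge to those of
the half-normal law, which are estimated at t < x and t' > x. *)
Lemma cvg_tail_recurrent :
  (fun n => tail S (k n.+1) n.+1 0) @ \oo --> 2 * (1 - Phi x).
Proof.
apply/cvgrPdist_le => e e0.
have e8 : 0 < e / 8 by rewrite divr_gt0.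
have [t [t' [t0 tx xt' tP t'P]]] := Phi_near e8.
have exp1 : expR (- 1) <= 1 :> R by rewrite expR_le1 oppr_le0.
have t'0 : 0 < t' := lt_trans x_gt0 xt'.
have c1 : expR (- (x ^+ 2 / t ^+ 2)) < expR (- 1) :> R.
  by rewrite ltr_expR ltrN2 ltr_pdivlMr ?exprn_gt0// mul1r ltrXn2r// ?nnegrE ltW.
have c2 : expR (- 1) < expR (- (x ^+ 2 / t' ^+ 2)) :> R.
  by rewrite ltr_expR ltrN2 ltr_pdivrMr ?exprn_gt0// mul1r ltrXn2r// ?nnegrE ltW.
have c3 : expR (- (x ^+ 2 / t' ^+ 2)) <= 1 :> R.
  by rewrite expR_le1 oppr_le0 divr_ge0 ?sqr_ge0.
have [q [q01 qle qge]] := exists_step_polynomial (expR_gt0 _) c1 exp1 e8.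
have [p [p01 ple pge]] := exists_step_polynomial (expR_gt0 _) c2 c3 e8.
have Eq : passage_transform sg x q <= 2 * (1 - Phi t) + 2 * (e / 8).
  apply: passage_transform_le => //; first exact: ltW.
  by move=> y /q01/andP[].
have Ep : (1 - e / 8) * (2 * (1 - Phi t')) <= passage_transform sg x p.
  apply: passage_transform_ge => //.
  by move=> y /p01/andP[].
move/cvgrPdist_le : (@transform_cvg q) => /(_ _ e8) Cq.
move/cvgrPdist_le : (@transform_cvg p) => /(_ _ e8) Cp.
near=> n.
have Dq : `|passage_transform sg x q - discrete_transform (fun m => tail S (k n.+1) m 0) (w n) q| <= e / 8.
  by near: n.
have Dp : `|passage_transform sg x p - discrete_transform (fun m => tail S (k n.+1) m 0) (w n) p| <= e / 8.
  by near: n.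
have a01 m := tail01 S (k n.+1) m 0.
have Bq := @discrete_transform_ge _ _ a01 (tail_nd S (k n.+1) 0) (w n) q (e / 8) n.+1 (w01 n).
have Bp := @discrete_transform_le _ _ a01 (tail_nd S (k n.+1) 0) (w n) p (e / 8) n.+1 (w01 n) (ltW e8).
rewrite wn in Bq Bp.
have {}Bq := Bq (fun y y01 => proj1 (andP (q01 y y01))) qge.
have {}Bp := Bp (fun y y01 => proj2 (andP (p01 y y01))) ple.
have /andP[a0 a1] := a01 n.+1.
have Pt1 := normal_cdf_le1 sg t'; have Pt0 := normal_cdf_ge0 sg t'.
have ea : e / 8 * tail S (k n.+1) n.+1 0 <= e / 8 by rewrite ler_piMr// ltW.
have eP : e / 8 * (1 - Phi t') <= e / 8 by rewrite ler_piMr ?(ltW e8)//; lra.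
move: Dq Dp; rewrite !ler_norml => /andP[Dq _] /andP[_ Dp].
apply/andP; split; lra.
Unshelve. all: by end_near. Qed.

End recurrent.

(** * The half-normal limit law *)

Section recurrent_law.
Context (R : realType) (S : step_set R).

Lemma step_meanE : derive1 (step_poly S) 1 =
  step_poly S 1 * \sum_(s : steps S) step_prob s * (val s)%:~R.
Proof.
rewrite step_poly_derive1 mulr_sumr; apply: eq_bigr => s _.
by rewrite mulrA [_ * step_prob s]mulrC /step_prob mulfVK// gt_eqF// step_poly1_gt0.
Qed.

Lemma step_varianceE : derive1 (step_poly S) 1 = 0 ->
  derive1n 2 (step_poly S) 1 =
  step_poly S 1 * \sum_(s : steps S) step_prob s * (val s)%:~R ^+ 2.
Proof.
move=> D0; rewrite step_poly_derive2 -[RHS]subr0 -[X in _ = _ - X]D0 step_poly_derive1.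
rewrite mulr_sumr -sumrB; apply: eq_bigr => s _.
rewrite mulrA [_ * step_prob s]mulrC /step_prob mulfVK ?gt_eqF ?step_poly1_gt0//.
by rewrite intrD intrN; ring.
Qed.

Lemma cdf_scaled_lt0 n (x : R) : x < 0 ->
  cdf (scaled_num_returns S n : {RV (walk_prob S n) >-> R}) x = 0%:E.
Proof.
move=> x0; rewrite /cdf /distribution /pushforward.
transitivity ((1 - tail S 0 n 0)%:E : \bar R); last by rewrite tail0 subrr.
apply: prob_returns_lt => w; rewrite ltn0/= in_itv/=; split => // wx.
have : 0 <= scaled_num_returns S n w by rewrite divr_ge0 ?ler0n ?sqrtr_ge0.
by move=> /le_trans/(_ wx); rewrite leNgt x0.
Qed.

Lemma cdf_scaled_ge0 n (x : R) : 0 <= x ->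
  cdf (scaled_num_returns S n.+1 : {RV (walk_prob S n.+1) >-> R}) x =
  (1 - tail S (Num.truncn (x * Num.sqrt n.+1%:R)).+1 n.+1 0)%:E.
Proof.
move=> x0; rewrite /cdf /distribution /pushforward.
apply: prob_returns_lt => w; rewrite /= in_itv/= /scaled_num_returns /num_returns.
by rewrite ltnS truncn_ge_nat ?mulr_ge0 ?sqrtr_ge0// ler_pdivrMr// sqrtr_gt0.
Qed.

Lemma halfnormal_cdf_lt0 (sg x : R) : sg != 0 -> x < 0 ->
  halfnormal_prob sg `]-oo, x]%classic = 0%:E.
Proof.
move=> s0 x0; apply: integral0_eq => y; rewrite /= in_itv/= => yx.
by rewrite /halfnormal_pdf (negbTE s0) leNgt (le_lt_trans yx x0).
Qed.

(** For x > 0 this is the convergence of the tails. At x = 0 the limit law has no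
atom, and the distribution functions are squeezed between 0 and their values at
small positive points. *)
Lemma returns_halfnormal : aperiodic S -> derive1 (step_poly S) 1 = 0 ->
  cvg_in_law (walk_prob S) (scaled_num_returns S)
    (halfnormal_prob (Num.sqrt (step_poly S 1 / derive1n 2 (step_poly S) 1))).
Proof.
move=> aper D0.
have mean0 : \sum_(s : steps S) step_prob s * (val s)%:~R = 0.
  by move: D0; rewrite step_meanE => /eqP; rewrite mulf_eq0 gt_eqF ?step_poly1_gt0// => /eqP.
set v := \sum_(s : steps S) step_prob s * (val s)%:~R ^+ 2.
have v0 : 0 < v := step_variance_gt0 S.
rewrite step_varianceE// invfM mulrA divff ?gt_eqF ?step_poly1_gt0// mul1r -/v.
set sg := Num.sqrt v^-1; have sg0 : 0 < sg by rewrite sqrtr_gt0 invr_gt0.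
pose F n (x : R) := 1 - tail S (Num.truncn (x * Num.sqrt n.+1%:R)).+1 n.+1 0.
have cdfF n x : 0 <= x ->
    cdf (scaled_num_returns S n.+1 : {RV (walk_prob S n.+1) >-> R}) x = (F n x)%:E.
  exact: cdf_scaled_ge0.
have F_cvg (x : R) : 0 < x -> F ^~ x @ \oo --> 2 * normal_cdf sg x - 1.
  move=> x0; rewrite (_ : 2 * _ - 1 = 1 - 2 * (1 - normal_cdf sg x)); last by ring.
  apply: cvgB; first exact: cvg_cst.
  exact: (cvg_tail_recurrent aper mean0 x0).
have cdf_cvg (x l : R) : 0 <= x -> F ^~ x @ \oo --> l ->
    cdf (scaled_num_returns S n : {RV (walk_prob S n) >-> R}) x @[n --> \oo] --> l%:E.
  move=> x0 Fl.
  suff : cdf (scaled_num_returns S n.+1 : {RV (walk_prob S n.+1) >-> R}) x @[n --> \oo] --> l%:E.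
    by rewrite (cvg_shiftS (fun n =>
      cdf (scaled_num_returns S n : {RV (walk_prob S n) >-> R}) x)).
  rewrite (_ : (fun n => _) = EFin \o F ^~ x); last by apply/funext => n; rewrite cdfF.
  by apply: cvg_EFin; first exact: nearW.
move=> x /= cF; have [x0|x0|x0] := ltgtP x 0.
- rewrite halfnormal_cdf_lt0 ?gt_eqF//; apply: cvg_near_cst.
  by apply: nearW => n; exact: cdf_scaled_lt0.
- by rewrite halfnormal_cdf ?(ltW x0)//; apply: cdf_cvg; [exact: ltW|exact: F_cvg].
rewrite {}x0 in cF *; rewrite halfnormal_cdf//.
have Phi0 : 2 * normal_cdf sg 0 - 1 = 0.
  have neg0 : (fun n => - n.+1%:R^-1 : R) @ \oo --> (0 : R).
    by rewrite -oppr0; apply: cvgN; exact: cvg_harmonic.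
  have := cvg_comp _ _ neg0 cF; rewrite halfnormal_cdf//.
  rewrite (_ : _ \o _ = cst 0%:E); last first.
    apply/funext => n /=; apply: halfnormal_cdf_lt0; first by rewrite gt_eqF.
    by rewrite oppr_lt0 invr_gt0.
  move=> /(cvg_unique (@ereal_hausdorff R) (cvg_cst _)) => -[].
  exact: esym.
rewrite Phi0; apply: cdf_cvg => //.
apply/cvgrPdist_le => e e0; have e4 : 0 < e / 4 by rewrite divr_gt0.
have cPhi : {for (0 : R), continuous (normal_cdf sg)}.
  apply/differentiable_continuous/derivable1_diffP.
  by have [] := is_derive_normal_cdf sg0 0.
have /cvgrPdist_le/(_ _ e4)/nbhs_ballP[d /= d0 Hd] := cPhi.
have d2 : 0 < d / 2 by rewrite divr_gt0.
have Hy : normal_cdf sg (d / 2) - normal_cdf sg 0 <= e / 4.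
  have /= := Hd (d / 2); rewrite /ball/= sub0r normrN gtr0_norm// => H.
  apply: le_trans (H _); last by rewrite ltr_pdivrMr// ltr_pMr// ltr1n.
  by rewrite distrC ler_norm.
have e2 : 0 < e / 2 by rewrite divr_gt0.
move/cvgrPdist_le : (F_cvg _ d2) => /(_ _ e2); apply: filterS => n.
rewrite ler_distl => /andP[Hn _].
have F0 : 0 <= F n 0.
  by rewrite -lee_fin -cdfF//; exact: cdf_ge0.
have Fm : F n 0 <= F n (d / 2).
  rewrite -lee_fin -!cdfF ?(ltW d2)//; apply: cdf_nondecreasing; exact: ltW.
rewrite sub0r normrN ger0_norm//; lra.
Qed.

End recurrent_law.


(** * The limit theorem *)

Theorem theorem3p6 (R : realType) (S : step_set R) :
  aperiodic S ->
  let P := step_poly S in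
  let delta := derive1 P 1 in
  (delta != 0 ->
     cvg_in_law (walk_prob S) (num_returns S)
       (geometric_prob (1 / bridge_gf S (1 / P 1))))
  /\
  (delta = 0 ->
     cvg_in_law (walk_prob S) (scaled_num_returns S)
       (halfnormal_prob (Num.sqrt (P 1 / derive1n 2 P 1)))).
Proof.
move=> aper P delta; split=> [|delta0]; first exact: returns_geometric.
exact: returns_halfnormal.
Qed.
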